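(* Let $p$ be a prime and let $G$ be a locally finite $p$-group which is a generalized $2$-Baer group. (i) If $p\neq 5$, then $G$ is soluble. (ii) If $p>5$, then $G$ is nilpotent of bounded class; that is, there is an absolute constant $c$ such that every such $G$ with $p>5$ is nilpotent of class at most $c$. (iii) If $p=5$ and $G$ is soluble, then $G$ is nilpotent of class bounded by a function depending on the derived length; that is, there is a function $f:\mathbb{N}\to\mathbb{N}$ such that every such $G$ with $p=5$ that is soluble of derived length $\ell$ is nilpotent of class at most $f(\ell)$.
   Context: A subgroup $H$ of a group $G$ is $2$-subnormal in $G$, written $H\lhd_2 G$, if there is a subgroup $H_1$ with $H\lhd H_1\lhd G$ (repetitions $H=H_1$ or $H_1=G$ are allowed). For a group $G$, $T_2(G)$ denotes the subgroup generated by all $x\in G$ such that $\langle x\rangle$ is not $2$-subnormal in $G$, with $T_2(G)=1$ if there are no such $x$. $G$ is a generalized $2$-Baer group if $T_2(G)\neq G$. *)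

(* Defs.v *)
From mathcomp Require Import all_boot.
From mathcomp Require Import classical_sets cardinality.

Set Implicit Arguments.
Unset Strict Implicit.
Unset Printing Implicit Defensive.

Local Open Scope classical_set_scope.
Local Open Scope group_scope.

(* Groups are arbitrary, possibly infinite, [groupType]s; subgroups are       *)
(* Prop-valued subsets [set G] of the carrier.                                *)
Definition is_subgroup (G : groupType) (H : set G) : Prop :=
  [/\ H 1,
      forall x y : G, H x -> H y -> H (x * y)
    & forall x : G, H x -> H x^-1].

Definition gen (G : groupType) (A : set G) : set G :=
  smallest (@is_subgroup G) A.

Definition cyc (G : groupType) (x : G) : set G := gen [set x].

Definition is_normal (G : groupType) (H K : set G) : Prop :=
  [/\ is_subgroup H, is_subgroup K, H `<=` K
    & forall h k : G, H h -> K k -> H (h ^ k)].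

Definition subnormal2 (G : groupType) (H : set G) : Prop :=
  exists H1 : set G, is_normal H H1 /\ is_normal H1 [set: G].

Definition T2 (G : groupType) : set G :=
  gen [set x : G | ~ subnormal2 (cyc x)].
Arguments T2 : clear implicits.

Definition generalized_2Baer (G : groupType) : Prop := T2 G <> [set: G].

Definition locally_finite_group (G : groupType) : Prop :=
  forall A : set G, finite_set A -> finite_set (gen A).

Definition p_group (p : nat) (G : groupType) : Prop :=
  forall x : G, exists k : nat, x ^+ (p ^ k)%N = 1.

Definition comm_subgroup (G : groupType) (A B : set G) : set G :=
  gen [set [~ a, b] | a in A & b in B].

(* Indexed from 0: [derived_series G 0] is the whole group. *)
Definition derived_series (G : groupType) (n : nat) : set G :=
  iter n (fun H : set G => comm_subgroup H H) [set: G].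
Arguments derived_series : clear implicits.

(* Indexed from 0: [lower_central G c] is the term usually written            *)
(* gamma_(c+1)(G), so it is trivial exactly when G has class at most c.       *)
Definition lower_central (G : groupType) (n : nat) : set G :=
  iter n (fun H : set G => comm_subgroup H [set: G]) [set: G].
Arguments lower_central : clear implicits.

Definition soluble (G : groupType) : Prop :=
  exists n : nat, derived_series G n = [set 1].

Definition soluble_of_length (G : groupType) (l : nat) : Prop :=
  derived_series G l = [set 1] /\
  forall m : nat, (m < l)%N -> derived_series G m <> [set 1].

Definition nilpotent_of_class_le (G : groupType) (c : nat) : Prop :=
  lower_central G c = [set 1].

(* Main.v *)
From HB Require Import structures.
From mathcomp Require Import boolp classical_sets cardinality.
From mathcomp Require Import all_boot all_fingroup all_solvable.
Require Import Defs.

Set Implicit Arguments.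
Unset Strict Implicit.
Unset Printing Implicit Defensive.

Local Open Scope group_scope.

(** Both the class and the derived length can be read off finite subgroups, so
    it is enough to bound them uniformly for a finite p-group G.  The proper
    subgroup T2(G) lies in a maximal subgroup T, and every x outside T generates
    a subgroup that is normal in the normal closure N_x of x.  The group N_x
    acts on each <[x ^ h]> through an abelian group, so it has class at most 2;
    commutators of conjugates of x are then bilinear, [~ x, x ^ h] lies in both
    <[x]> and <[x ^ h]>, and [~ g, x, x, x] = 1 for all g
    ([baer2_nclosure_class2], [baer2_engel3]).

    The heart of the proof is that v = [~ x, x ^ c] generates a normal subgroup
    of G when p is odd ([comm_normal_odd]).  Otherwise some conjugate b of x has
    <[x]> and <[b]> almost independent, and the hypothesis on the element x * b,
    which is also outside T, is violated: a suitable conjugate of x * b has with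
    x * b a commutator whose component is v in <[x]> and negligible in <[b]>.
    For p = 2, where x * b is in T, the element x * b ^+ 2 shows that <[v ^+ 2]>
    is normal for v of maximal order ([comm_sqr_normal]).  A cyclic normal
    subgroup is centralized by G', so all [~ x, x ^ h], or their squares when
    p = 2, are in the centre Z of G'.

    For p odd, the elements outside T thus commute with their conjugates modulo
    Z.  By polarization this makes all commutators of weight 4 alternating
    modulo those of weight 5, and they vanish by the Jacobi identity
    ([engel2_lcn4]): 'L_4(G) is contained in Z, so G'' is contained in Z and
    G''' = 1.  For p = 2 the elements [~ x, x ^ h] are modulo Z commuting
    involutions ([commute_comm_involutions]); factoring out the abelian normal
    subgroup that they generate leads to the same situation, at the cost of one
    more step in the derived series.

    If moreover p > 3, then G acts on the abelian group 'L_4(G) through an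
    abelian quotient, with (x - 1)^3 = 0 for x outside T.  Polarizing this
    relation, where 6 is invertible, kills [~ a, x, y, z] modulo 'L_8(G) for a
    in 'L_4(G), whence 'L_7(G) = 1 ([engel3_lcn7]).  So the class is at most 6
    for all p > 3, in particular for p = 5 whatever the derived length, and the
    derived length is at most 4 for every p. *)

(** * Commutators along the lower central series *)

Section LowerCentralCalculus.

Variables (gT : finGroupType) (G : {group gT}).
Implicit Types (a b u v x y z w : gT) (s : seq gT).

Lemma mem_lcnS n u x : u \in 'L_n(G) -> x \in G -> [~ u, x] \in 'L_n.+1(G).
Proof. by move=> Lu Gx; apply: (subsetP (lcnSnS n G)); apply: mem_commg. Qed.

Lemma mem_lcnG n u : u \in 'L_n(G) -> u \in G.
Proof. exact: (subsetP (lcn_sub n G)). Qed.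

(** The three subgroup lemma, applied modulo the target: commutation with G
    twice already moves down two steps. *)
Lemma lcn_comm2 n : [~: 'L_n(G), 'L_2(G)] \subset 'L_n.+2(G).
Proof.
have nL (H : {set gT}) : H \subset G -> H \subset 'N('L_n.+2(G)).
  by move=> sHG; exact: (subset_trans sHG (lcn_norm n.+2 G)).
have sLG k : 'L_k(G) \subset G := lcn_sub k G.
have nR k : [~: 'L_k(G), G] \subset 'L_k.+1(G) := lcnSnS k G.
have kill : [~: 'L_n(G), G, G] \subset 'L_n.+2(G).
  exact: subset_trans (commSg _ (nR n)) (nR n.+1).
have qR : [~: 'L_n(G) / 'L_n.+2(G), G / 'L_n.+2(G), G / 'L_n.+2(G)] = 1.
  by rewrite -!quotientR ?nL ?comm_subG // quotientS1.
rewrite -quotient_sub1 ?nL ?comm_subG // quotientR ?nL // lcn2 derg1.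
rewrite quotientR ?nL // commGC; apply/trivgP.
by apply: three_subgroup; rewrite // (commGC (G / _)).
Qed.

(** Congruence modulo 'L_n(G).  Identities that hold exactly in the Lie ring
    of the lower central series hold in G as such congruences. *)
Definition eqlcn n a b := a * b^-1 \in 'L_n(G).

Lemma eqlcn_refl n a : eqlcn n a a.
Proof. by rewrite /eqlcn mulgV group1. Qed.

Lemma eqlcn_trans n b a c : eqlcn n a b -> eqlcn n b c -> eqlcn n a c.
Proof. by rewrite /eqlcn => ab bc; rewrite -(mulgKV b a) -mulgA groupM. Qed.

Lemma eqlcnM n a a' b b' :
  a' \in G -> eqlcn n a a' -> eqlcn n b b' -> eqlcn n (a * b) (a' * b').
Proof.
rewrite /eqlcn => Ga' aa' bb'.
have -> : a * b * (a' * b')^-1 = (a * a'^-1) * (b * b'^-1) ^ a'^-1.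
  by rewrite /conjg invgK invMg !mulgA mulgKV.
by rewrite groupM // memJ_norm // groupV (subsetP (lcn_norm n G)).
Qed.

Lemma eqlcn1 n a b : 'L_n(G) = 1 -> eqlcn n a b -> a = b.
Proof. by rewrite /eqlcn => -> /set1P/eqP; rewrite -eq_mulgV1 => /eqP. Qed.

Lemma eqlcn_mulr n a e : e \in 'L_n(G) -> a \in G -> eqlcn n (a * e) a.
Proof.
move=> Le Ga; have -> : eqlcn n (a * e) a = (e ^ a^-1 \in 'L_n(G)).
  by rewrite /eqlcn conjgE invgK mulgA.
by rewrite memJ_norm // groupV (subsetP (lcn_norm n G)).
Qed.

Lemma eqlcn_mulC n a b : [~ a, b] \in 'L_n(G) -> a \in G -> b \in G ->
  eqlcn n (a * b) (b * a).
Proof.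
by move=> Lab Ga Gb; rewrite commgC; apply: eqlcn_mulr Lab _; rewrite groupM.
Qed.

Lemma eqlcn_commg n a a' x : a' \in G -> x \in G ->
  eqlcn n a a' -> eqlcn n.+1 [~ a, x] [~ a', x].
Proof.
move=> Ga' Gx; rewrite /eqlcn => e.
rewrite -[a in [~ a, x]](mulgKV a') commMgJ mulgK memJ_norm ?mem_lcnS //.
exact: subsetP (lcn_norm _ _) _ Ga'.
Qed.

Lemma eqlcn_commMg n u v x : u \in 'L_n(G) -> v \in 'L_n(G) -> x \in G ->
  eqlcn n.+2 [~ u * v, x] ([~ u, x] * [~ v, x]).
Proof.
move=> Lu Lv Gx; have Lux := mem_lcnS Lu Gx.
rewrite commMgR; apply: eqlcnM (eqlcn_refl _ _); first exact: mem_lcnG Lux.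
by apply: eqlcn_mulr (mem_lcnG Lux); apply: mem_lcnS (mem_lcnG Lv).
Qed.

Lemma eqlcn_commgM n u x y : u \in 'L_n(G) -> x \in G -> y \in G ->
  eqlcn n.+2 [~ u, x * y] ([~ u, x] * [~ u, y]).
Proof.
move=> Lu Gx Gy; have Lx := mem_lcnS Lu Gx; have Ly := mem_lcnS Lu Gy.
have [Gux Guy] := (mem_lcnG Lx, mem_lcnG Ly).
rewrite commgMR; apply: (@eqlcn_trans _ ([~ u, y] * [~ u, x])).
  by apply: eqlcn_mulr; [apply: mem_lcnS | rewrite groupM].
by apply: eqlcn_mulC; [apply: mem_lcnS | |].
Qed.

Lemma eqlcn_mulIl n q a b : q \in G -> eqlcn n (q * a) (q * b) -> eqlcn n a b.
Proof.
move=> Gq; rewrite {2}/eqlcn; have -> : a * b^-1 = (q * a * (q * b)^-1) ^ q.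
  by rewrite conjgE invMg !mulgA mulVg mul1g mulgKV.
by rewrite memJ_norm // (subsetP (lcn_norm n G)).
Qed.

(** The Jacobi identity for u, x, y.  The index of u is at least 1 because the
    two commutators [~ u, x] and [~ u, y] have to commute modulo the target,
    which needs one of them to lie in 'L_2(G). *)
Lemma eqlcn_Jacobi n u x y : u \in 'L_n.+1(G) -> x \in G -> y \in G ->
  eqlcn n.+4 [~ u, x, y] ([~ u, [~ x, y]] * [~ u, y, x]).
Proof.
move=> Lu Gx Gy; have Lx := mem_lcnS Lu Gx; have Ly := mem_lcnS Lu Gy.
have [Gux Guy] := (mem_lcnG Lx, mem_lcnG Ly).
have Gu := mem_lcnG Lu; have Gt := groupR Gx Gy.
have Lt : [~ u, [~ x, y]] \in 'L_n.+3(G).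
  by apply: (subsetP (lcn_comm2 n.+1)); rewrite mem_commg // mem_commg.
pose q := [~ u, y] * [~ u, x].
have Gq : q \in G by rewrite groupM.
(* Both sides come from expanding [~ u, x * y] = [~ u, y * x * [~ x, y]]. *)
apply: (eqlcn_mulIl Gq); rewrite -commgMR commgC commgMR.
apply: (@eqlcn_trans _ ([~ u, [~ x, y]] * [~ u, y * x])).
  have Lyx : [~ u, y * x] \in 'L_n.+2(G) by rewrite mem_lcnS // groupM.
  apply: eqlcn_mulr; last by rewrite (groupM (groupR Gu Gt)) // (mem_lcnG Lyx).
  by apply: (subsetP (lcn_comm2 n.+2)); rewrite mem_commg // mem_commg.
have Gyx : [~ u, y, x] \in G by rewrite groupR.
rewrite commgMR (mulgA _ ([~ u, x] * [~ u, y])) (mulgA q).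
apply: eqlcnM (eqlcn_refl _ _); first exact: groupM Gq (groupR _ _).
apply: (@eqlcn_trans _ ([~ u, [~ x, y]] * q)); last first.
  exact: eqlcn_mulC (mem_lcnS Lt Gq) (mem_lcnG Lt) Gq.
apply: eqlcnM (eqlcn_refl _ _) _; first exact: mem_lcnG Lt.
apply: eqlcn_mulC => //; apply: (subsetP (lcn_comm2 n.+2)).
by rewrite mem_commg // (subsetP (lcn_sub_leq G (isT : 2 <= n.+2))).
Qed.

(** The left-normed commutator [~ a, x_1, ..., x_k]. *)
Fixpoint lnormed a s := if s is x :: s' then lnormed [~ a, x] s' else a.

Lemma lnormed_lcn n a s : a \in 'L_n(G) -> all (mem G) s ->
  lnormed a s \in 'L_(n + size s)(G).
Proof.
elim: s a n => [|x s IHs] a n La /=; first by rewrite addn0.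
by case/andP=> Gx Gs; rewrite addnS -addSn IHs ?mem_lcnS.
Qed.

Lemma eqlcn_lnormed n a a' s : a \in G -> a' \in G -> all (mem G) s ->
  eqlcn n a a' -> eqlcn (n + size s) (lnormed a s) (lnormed a' s).
Proof.
elim: s a a' n => [|x s IHs] a a' n Ga Ga' /=; first by rewrite addn0.
by case/andP=> Gx Gs ?; rewrite addnS -addSn IHs ?groupR ?eqlcn_commg.
Qed.

Lemma eqlcn_lnormedMl n a b s : a \in 'L_n(G) -> b \in 'L_n(G) ->
  all (mem G) s ->
  eqlcn (n + size s).+1 (lnormed (a * b) s) (lnormed a s * lnormed b s).
Proof.
elim: s a b n => [|x s IHs] a b n La Lb /=; first by rewrite eqlcn_refl.
case/andP=> Gx Gs; have [Ga Gb] := (mem_lcnG La, mem_lcnG Lb).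
apply: (@eqlcn_trans _ (lnormed ([~ a, x] * [~ b, x]) s)).
  rewrite addnS -!addSn; apply: eqlcn_lnormed Gs (eqlcn_commMg La Lb Gx).
    exact: groupR (groupM Ga Gb) Gx.
    exact: groupM (groupR Ga Gx) (groupR Gb Gx).
by rewrite addnS -addSn IHs ?mem_lcnS.
Qed.

(** A left-normed commutator is a product in each entry, up to one step
    further down the series; this is what makes polarization possible. *)
Lemma eqlcn_lnormedM n a x y s t : a \in 'L_n(G) -> x \in G -> y \in G ->
  all (mem G) s -> all (mem G) t ->
  eqlcn (n + size (s ++ x :: t)).+1 (lnormed a (s ++ (x * y) :: t))
       (lnormed a (s ++ x :: t) * lnormed a (s ++ y :: t)).
Proof.
move=> La Gx Gy Gs Gt; elim: s a n La Gs => [|z s IHs] a n La /=.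
  move=> _; have Ga := mem_lcnG La.
  apply: (@eqlcn_trans _ (lnormed ([~ a, x] * [~ a, y]) t)).
    rewrite addnS -!addSn; apply: eqlcn_lnormed Gt (eqlcn_commgM La Gx Gy).
      exact: groupR Ga (groupM Gx Gy).
    exact: groupM (groupR Ga Gx) (groupR Ga Gy).
  by rewrite addnS -addSn eqlcn_lnormedMl ?mem_lcnS.
by case/andP=> Gz Gs; rewrite addnS -addSn IHs ?mem_lcnS.
Qed.

Lemma lcn_last_cent n x y : 'L_n.+1(G) = 1 -> x \in 'L_n(G) -> y \in G ->
  commute x y.
Proof.
move=> L1 Lx Gy; apply/commgP; rewrite -in_set1 -[[set 1]]L1.
exact: mem_lcnS.
Qed.

Lemma lnormedM n a x y s t : 'L_(n + size (s ++ x :: t)).+1(G) = 1 ->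
  a \in 'L_n(G) -> x \in G -> y \in G -> all (mem G) s -> all (mem G) t ->
  lnormed a (s ++ (x * y) :: t) =
    lnormed a (s ++ x :: t) * lnormed a (s ++ y :: t).
Proof. by move=> L1 La *; apply: (eqlcn1 L1 (eqlcn_lnormedM La _ _ _ _)). Qed.

End LowerCentralCalculus.

Lemma p_elt_expg1 (gT : finGroupType) (p k : nat) (G : {group gT}) (x : gT) :
  p.-group G -> x \in G -> coprime p k -> x ^+ k = 1 -> x = 1.
Proof.
move=> pG Gx co /eqP; rewrite -order_dvdn => dv.
apply/eqP; rewrite -order_eq1 -dvdn1 -(eqnP (_ : coprime #[x] k)).
  by rewrite dvdn_gcd dvdnn.
by have [n ->] := p_natP (mem_p_elt pG Gx); rewrite coprimeXl.
Qed.

Lemma mem_ucnS (gT : finGroupType) (G : {group gT}) n x :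
  x \in G -> {in G, forall y, [~ x, y] \in 'Z_n(G)} -> x \in 'Z_n.+1(G).
Proof.
move=> Gx cx; rewrite ucnSnR inE Gx gen_subG.
by apply/subsetP=> _ /imset2P[_ y /set1P-> Gy ->]; apply: cx.
Qed.

(** In a nilpotent group a lower central series that stops descending is
    trivial from there on.  Together with [lcn_stable_quotient] this reduces a
    bound on the class to a computation with central commutators of top
    weight, which are exactly multilinear. *)
Lemma lcn_stable (gT : finGroupType) (G : {group gT}) n :
  nilpotent G -> 'L_n.+1(G) \subset 'L_n.+2(G) -> 'L_n.+1(G) = 1.
Proof.
case/lcnP=> m Lm1 sL; apply/trivgP; rewrite -Lm1.
have sLk k : 'L_n.+1(G) \subset 'L_(n + k).+1(G).
  elim: k => [|k IHk]; first by rewrite addn0.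
  by apply: subset_trans sL _; rewrite addnS !lcnSn commSg.
by apply: subset_trans (sLk m) _; rewrite lcn_sub_leq // ltnS leq_addl.
Qed.

Lemma quotient_lcn (gT : finGroupType) (G M : {group gT}) n :
  M <| G -> 'L_n(G) / M = 'L_n(G / M).
Proof. by move=> nMG; apply: morphim_lcn; apply: normal_norm. Qed.

Lemma lcn_stable_quotient (gT : finGroupType) (G : {group gT}) n :
  nilpotent G -> 'L_n.+1(G / 'L_n.+2(G)) = 1 -> 'L_n.+1(G) = 1.
Proof.
move=> nilG; rewrite -quotient_lcn ?lcn_normal // => /trivgP.
rewrite quotient_sub1; last exact: subset_trans (lcn_sub _ _) (lcn_norm _ _).
exact: lcn_stable nilG.
Qed.

(** * Elements outside a proper subgroup *)

Section Outside.

Variables (gT : finGroupType) (G T : {group gT}).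
Hypothesis prTG : T \proper G.

Lemma exists_outside : exists2 u, u \in G & u \notin T.
Proof. by case/properP: prTG => _ [u Gu]; exists u. Qed.

(** An element t of T is u^-1 * (u * t), both factors lying outside T. *)
Lemma outside_ind (P : gT -> Prop) :
  (forall x, x \in G -> x \notin T -> P x) ->
  (forall x y, x \in G -> y \in G -> P x -> P y -> P (x * y)) ->
  forall x, x \in G -> P x.
Proof.
move=> Pout PM x Gx; have [u Gu Tu] := exists_outside.
have [Tx|] := boolP (x \in T); last exact: Pout.
have Gux := groupM Gu Gx.
rewrite -(mulKg u x); apply: (PM) => //; first by rewrite groupV.
  by apply: Pout; rewrite groupV.
by apply: Pout => //; rewrite groupMr.
Qed.

Lemma outside_sub (K : {group gT}) :
  (forall x, x \in G -> x \notin T -> x \in K) -> G \subset K.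
Proof.
move=> sK; apply/subsetP=> x Gx; pattern x.
by apply: outside_ind Gx => // y z _ _; apply: groupM.
Qed.

End Outside.

Lemma lift_outside (gT : finGroupType) (G T M : {group gT}) X :
  M \subset T -> X \in G / M -> X \notin T / M ->
  exists x, [/\ x \in G, x \in 'N(M), x \notin T & X = coset M x].
Proof.
move=> sMT /morphimP[x Nx Gx ->{X}] nTx; exists x; split=> //.
by apply: contra nTx => Tx; rewrite mem_quotient.
Qed.

Lemma quotient_outside (gT : finGroupType) (G T M : {group gT}) :
  M <| G -> M \subset T -> T \proper G -> T / M \proper G / M.
Proof.
move=> nMG sMT /andP[sTG nsGT]; apply/andP; split; first exact: quotientS.
by rewrite quotientSGK // normal_norm.
Qed.

(** * Two-Engel elements outside a subgroup *)

Section Bilinear.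

Variables (gT : finGroupType) (p : nat) (G T Z : {group gT}).
Variable B : gT -> gT -> gT.
Hypotheses (pZ : p.-group Z) (cZ : abelian Z) (prTG : T \proper G).
Hypothesis BZ : {in G &, forall x y, B x y \in Z}.
Hypothesis BMl : {in G & &, forall x y z, B (x * y) z = B x z * B y z}.
Hypothesis BMr : {in G & &, forall x y z, B x (y * z) = B x y * B x z}.
Hypothesis B0 : {in G, forall x, x \notin T -> B x x = 1}.

Lemma bilinear_sq x y : x \in G -> y \in G ->
  B (x * y) (x * y) = B x x * B y y * (B x y * B y x).
Proof.
move=> Gx Gy; rewrite BMl ?groupM // !BMr // -!mulgA; congr (_ * _).
by rewrite mulgA -(centsP cZ (B y y)) ?groupM ?BZ.
Qed.

(** For t in T and u outside T, the vanishing of B at u * t and u * t^-1 gives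
    B t t * s = 1 and B t t * s^-1 = 1, where s = B u t * B t u; hence the
    square of B t t is trivial. *)
Lemma alternating_of_outside : coprime p 2 -> {in G, forall x, B x x = 1}.
Proof.
move=> co2 t Gt; have [Tt|] := boolP (t \in T); last exact: B0.
have [u Gu Tu] := exists_outside prTG.
have out s : s \in T -> s \in G -> B s s * (B u s * B s u) = 1.
  move=> Ts Gs; have := B0 (groupM Gu Gs); rewrite groupMr // => /(_ Tu).
  by rewrite bilinear_sq // (B0 Gu Tu) mul1g.
have B1l y : y \in G -> B 1 y = 1.
  by move=> Gy; apply: (mulgI (B 1 y)); rewrite -BMl ?mulg1.
have B1r y : y \in G -> B y 1 = 1.
  by move=> Gy; apply: (mulgI (B y 1)); rewrite -BMr ?mulg1.
have BVl x y : x \in G -> y \in G -> B x^-1 y = (B x y)^-1.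
  by move=> Gx Gy; apply: (mulgI (B x y)); rewrite -BMl ?groupV // !mulgV B1l.
have BVr x y : x \in G -> y \in G -> B x y^-1 = (B x y)^-1.
  by move=> Gx Gy; apply: (mulgI (B x y)); rewrite -BMr ?groupV // !mulgV B1r.
have ut := out t Tt Gt.
have := out t^-1; rewrite !groupV !BVr ?groupV // !BVl // invgK => /(_ Tt Gt).
rewrite -invMg (centsP cZ _ (BZ Gt Gu) _ (BZ Gu Gt)) => uV.
apply: (p_elt_expg1 pZ (BZ Gt Gt) co2).
have /eqP Dt : B t t == (B u t * B t u)^-1 by rewrite eq_mulgV1 invgK ut.
by rewrite expgS expg1 {2}Dt.
Qed.

Lemma skew_of_alternating : {in G, forall x, B x x = 1} ->
  {in G &, forall x y, B x y * B y x = 1}.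
Proof.
move=> alt x y Gx Gy; have := bilinear_sq Gx Gy.
by rewrite !alt ?groupM // !mul1g.
Qed.

End Bilinear.

Definition engel2_outside (gT : finGroupType) (G T : {set gT}) :=
  {in G &, forall g x, x \notin T -> [~ g, x, x] = 1}.

Section TwoEngel.

Variables (gT : finGroupType) (p : nat) (G T : {group gT}).
Hypotheses (pG : p.-group G) (prTG : T \proper G).
Hypothesis eng : engel2_outside G T.

Lemma skew_comm n a : coprime p 2 -> 'L_n.+4(G) = 1 -> a \in 'L_n.+1(G) ->
  {in G &, forall x y, [~ a, x, y] * [~ a, y, x] = 1}.
Proof.
move=> co2 L1 La.
have LB x y : x \in G -> y \in G -> [~ a, x, y] \in 'L_n.+3(G).
  by move=> Gx Gy; do 2!apply: mem_lcnS => //.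
have cL : abelian 'L_n.+3(G).
  by apply/centsP=> x Lx y Ly; apply: lcn_last_cent L1 Lx (mem_lcnG Ly).
have pL : p.-group 'L_n.+3(G) := pgroupS (lcn_sub _ _) pG.
have Bl : {in G & &, forall x y z, [~ a, x * y, z] = [~ a, x, z] * [~ a, y, z]}.
  move=> x y z Gx Gy Gz; apply: (@lnormedM _ G n.+1 a x y [::] [:: z]) => //=.
    by rewrite addn2.
  by rewrite Gz.
have Br : {in G & &, forall x y z, [~ a, x, y * z] = [~ a, x, y] * [~ a, x, z]}.
  move=> x y z Gx Gy Gz; apply: (@lnormedM _ G n.+1 a y z [:: x] [::]) => //=.
    by rewrite addn2.
  by rewrite Gx.
pose B x y := [~ a, x, y].
apply: (@skew_of_alternating _ G 'L_n.+3(G)%G B) => //.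
apply: (@alternating_of_outside _ p G T 'L_n.+3(G)%G B) => // x Gx.
exact: eng (mem_lcnG La) Gx.
Qed.

End TwoEngel.

Section TwoEngelQuotient.

Variables (gT : finGroupType) (p : nat) (G T : {group gT}).
Hypotheses (pG : p.-group G) (prTG : T \proper G).
Hypothesis eng : engel2_outside G T.

Lemma engel2_quotient (M : {group gT}) : M <| G -> M \subset T ->
  engel2_outside (G / M) (T / M).
Proof.
move=> nMG sMT _ X /morphimP[g Ng Gg ->] GX nTX.
have [x [Gx Nx nTx ->]] := lift_outside sMT GX nTX.
by rewrite -!morphR ?groupR // (eng Gg Gx nTx) morph1.
Qed.

Lemma skew_comm_mod n a x y : odd p -> 'L_n.+4(G) \subset T ->
  a \in 'L_n.+1(G) -> x \in G -> y \in G ->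
  [~ a, x, y] * [~ a, y, x] \in 'L_n.+4(G).
Proof.
move=> oddp sLT La Gx Gy; pose L : {group gT} := 'L_n.+4(G)%G.
have nL := subsetP (lcn_norm n.+4 G); have Ga := mem_lcnG La.
have nLG : L <| G := lcn_normal _ _.
have cL : 'L_n.+4(G / L) = 1.
  by rewrite -quotient_lcn // trivg_quotient.
have qL z k : z \in 'L_k(G) -> coset L z \in 'L_k(G / L).
  by move=> Lz; rewrite -quotient_lcn // mem_quotient.
have := @skew_comm _ p (G / L)%G (T / L)%G (quotient_pgroup _ pG)
  (quotient_outside nLG sLT prTG) (engel2_quotient nLG sLT) n (coset L a).
rewrite coprimen2 oddp => /(_ isT cL (qL _ _ La) (coset L x) (coset L y)).
rewrite !mem_quotient // => /(_ isT isT); rewrite -!morphR ?groupR ?nL //.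
rewrite -morphM ?groupR ?nL // => /coset_idr; apply.
by rewrite groupM ?groupR ?nL.
Qed.

End TwoEngelQuotient.

Section TwoEngelClass.

Variables (gT : finGroupType) (p : nat) (G T : {group gT}).
Hypotheses (pG : p.-group G) (prTG : T \proper G) (sG'T : G^`(1) \subset T).
Hypothesis eng : engel2_outside G T.

(** The commutator f x y z w = [~ x, y, z, w] changes sign under every
    transposition of adjacent entries.  Hence [~ x, y, [~ z, w]] is f^2 by the
    Jacobi identity; exchanging the pairs (x, y) and (z, w) inverts this
    commutator but is an even permutation of the entries, so f^4 = 1. *)
Lemma engel2_odd_lcn5 : odd p -> 'L_5(G) = 1 ->
  {in G & G, forall x y, {in G &, forall z w, [~ x, y, z, w] = 1}}.
Proof.
move=> oddp L5 x1 x2 Gx1 Gx2 x3 x4 Gx3 Gx4.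
pose f (x y z w : gT) := [~ x, y, z, w].
have co2 : coprime p 2 by rewrite coprimen2.
have L2 x y : x \in G -> y \in G -> [~ x, y] \in 'L_2(G).
  by move=> Gx Gy; apply: mem_commg.
have Lf x y z w : x \in G -> y \in G -> z \in G -> w \in G ->
  f x y z w \in 'L_4(G).
  by move=> *; do 2!apply: mem_lcnS => //; apply: L2.
have sL4T : 'L_4(G) \subset T.
  exact: subset_trans (lcn_sub_leq G (isT : 2 <= 4)) sG'T.
have sk12 x y z w : x \in G -> y \in G -> z \in G -> w \in G ->
  f y x z w = (f x y z w)^-1.
  move=> Gx Gy Gz Gw; apply/eqP; rewrite eq_sym eq_invg_mul; apply/eqP.
  have Gs : all (mem G) [:: z; w] by rewrite /= Gz Gw.
  have /= <- := eqlcn1 L5 (eqlcn_lnormedMl (L2 _ _ Gx Gy) (L2 _ _ Gy Gx) Gs).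
  by rewrite -(invg_comm x y) mulgV !comm1g.
have sk23 x y z w : x \in G -> y \in G -> z \in G -> w \in G ->
  f x z y w = (f x y z w)^-1.
  move=> Gx Gy Gz Gw; apply/eqP; rewrite eq_sym eq_invg_mul; apply/eqP.
  have Gs : all (mem G) [:: w] by rewrite /= Gw.
  have L3 y' z' : y' \in G -> z' \in G -> [~ x, y', z'] \in 'L_3(G).
    by move=> *; apply: mem_lcnS => //; apply: L2.
  have /= <- := eqlcn1 L5 (eqlcn_lnormedMl (L3 _ _ Gy Gz) (L3 _ _ Gz Gy) Gs).
  have := @skew_comm_mod _ p G T pG prTG eng 0 x y z oddp sL4T Gx Gy Gz.
  by move/mem_lcnS=> /(_ w Gw); rewrite L5 => /set1P.
have sk34 x y z w : x \in G -> y \in G -> z \in G -> w \in G ->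
  f x y w z = (f x y z w)^-1.
  move=> Gx Gy Gz Gw; apply/eqP; rewrite eq_sym eq_invg_mul; apply/eqP.
  exact: (skew_comm pG prTG eng co2 L5 (L2 _ _ Gx Gy)).
have fR x y z w : x \in G -> y \in G -> z \in G -> w \in G ->
  [~ x, y, [~ z, w]] = f x y z w ^+ 2.
  move=> Gx Gy Gz Gw; have := eqlcn1 L5 (eqlcn_Jacobi (L2 _ _ Gx Gy) Gz Gw).
  rewrite -!/(f _ _ _ _) (sk34 x y z w) // => e.
  by rewrite expgS expg1 {1}e mulgKV.
have fV : f x3 x4 x1 x2 = f x1 x2 x3 x4.
  rewrite (sk23 x3 x1) // (sk12 x1 x3) // (sk34 x1 x3 x2) // (sk23 x1 x2) //.
  by rewrite !invgK.
apply: (p_elt_expg1 pG _ (_ : coprime p (2 * 2))); rewrite ?coprimeMr ?co2 //.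
  exact: mem_lcnG (Lf _ _ _ _ _ _ _ _).
rewrite expgM -fR // expgS expg1 {1}fR // -fV -fR //.
by rewrite -(invg_comm [~ x1, x2]) mulVg.
Qed.

(** For p = 2 the polarization must stay outside T, so it uses the product of
    three elements outside T, which is again outside T when T has index 2.
    It makes f x y z = [~ x, y, z] alternating on G outside T, and then the
    Jacobi identity reads f^3 = 1. *)
Lemma engel2_two_lcn4 : p = 2 ->
  {in G &, forall x y, x \notin T -> y \notin T -> x * y \in T} ->
  'L_4(G) = 1 -> 'L_3(G) = 1.
Proof.
move=> p2 idx L4; pose f (x y z : gT) := [~ x, y, z].
have L2 x y : x \in G -> y \in G -> [~ x, y] \in 'L_2(G).
  by move=> Gx Gy; apply: mem_commg.
have f_mid x y y' z : x \in G -> y \in G -> y' \in G -> z \in G ->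
  f x (y * y') z = f x y z * f x y' z.
  move=> Gx Gy Gy' Gz.
  by apply: (@lnormedM _ G 1 x y y' [::] [:: z]); rewrite //= Gz.
have f_last x y z z' : x \in G -> y \in G -> z \in G -> z' \in G ->
  f x y (z * z') = f x y z * f x y z'.
  move=> Gx Gy Gz Gz'.
  by apply: (@lnormedM _ G 1 x z z' [:: y] [::]); rewrite //= Gy.
have sk12 x y z : x \in G -> y \in G -> z \in G -> f y x z = (f x y z)^-1.
  move=> Gx Gy Gz; rewrite /f -(invg_comm x y) commVg //; apply: commute_sym.
  exact: lcn_last_cent L4 (mem_lcnS (L2 _ _ Gx Gy) Gz) (groupR Gx Gy).
have fyy x y : x \in G -> y \in G -> y \notin T -> f x y y = 1.
  by move=> *; apply: eng.
have fyx x y : x \in G -> y \in G -> x \notin T -> f x y x = 1.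
  by move=> Gx Gy Tx; rewrite sk12 // fyy // invg1.
have sk23 x y z : x \in G -> y \in G -> z \in G ->
  x \notin T -> y \notin T -> z \notin T -> f x z y = (f x y z)^-1.
  move=> Gx Gy Gz Tx Ty Tz; apply/eqP; rewrite eq_sym eq_invg_mul; apply/eqP.
  have Gxyz : x * y * z \in G by rewrite !groupM.
  have Txyz : x * y * z \notin T by rewrite groupMl // idx.
  have := fyy x _ Gx Gxyz Txyz.
  rewrite f_mid ?groupM // f_mid // !f_last ?groupM // {1 2 3}/f commgg !comm1g.
  by rewrite fyx // fyy // (fyx x z) // (fyy x z) // !mul1g mulg1.
have f0 x y z : x \in G -> y \in G -> z \in G ->
  x \notin T -> y \notin T -> z \notin T -> f x y z = 1.
  move=> Gx Gy Gz Tx Ty Tz.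
  have Gf : f x y z \in G by rewrite !groupR.
  apply: (p_elt_expg1 pG Gf (_ : coprime p 3)); first by rewrite p2.
  have fzxy : f y z x = f x y z.
    by rewrite sk12 // sk23 // (sk12 x z y) // (sk23 x y z) // !invgK.
  have := eqlcn1 L4 (eqlcn_Jacobi (Gx : x \in 'L_1(G)) Gy Gz).
  rewrite -(invg_comm [~ y, z]) -!/(f _ _ _) fzxy (sk23 x y z) // => e.
  by rewrite !expgS mulg1 {1}e -mulgA mulKg mulVg.
apply/eqP; rewrite (ucn_lcnP 2) eqEsubset ucn_sub /=.
apply: (outside_sub prTG) => x Gx Tx; apply: mem_ucnS => // y.
rewrite ucn1; move: y; apply: (outside_ind prTG) => [y Gy Ty | y z Gy Gz Zy Zz].
  rewrite inE groupR //= -sub_cent1; apply: (outside_sub prTG) => z Gz Tz.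
  by apply/cent1P/esym/commgP/eqP; apply: f0.
have /eqP R1 : [~ x, y, z] == 1.
  by apply/commgP; case/setIP: Zy => _ /centP; apply.
by rewrite commgMR R1 mulg1; apply: groupM.
Qed.

End TwoEngelClass.

Section MaximalSubgroup.

Variables (gT : finGroupType) (p : nat) (G T : {group gT}).
Hypotheses (pr_p : prime p) (pG : p.-group G) (maxT : maximal T G).

Lemma max_proper : T \proper G.
Proof. exact: maxgroupp maxT. Qed.

Lemma max_der1 : G^`(1) \subset T.
Proof.
have nTG := p_maximal_normal pG maxT; apply: der1_min (normal_norm nTG) _.
apply: cyclic_abelian; apply: prime_cyclic.
by rewrite card_quotient ?normal_norm // (p_maximal_index pG maxT).
Qed.

Lemma max_mul_outside : p = 2 ->
  {in G &, forall x y, x \notin T -> y \notin T -> x * y \in T}.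
Proof.
move=> p2 x y Gx Gy Tx Ty; have sTG := proper_sub max_proper.
have nTG := p_maximal_normal pG maxT; have nT := subsetP (normal_norm nTG).
have /cards1P[z Dz] : #|(G / T)^#| == 1%N.
  have oQ : #|G / T| = 2.
    by rewrite card_quotient ?normal_norm // (p_maximal_index pG maxT).
  by have := cardsD1 1 (G / T); rewrite group1 oQ add1n => -[<-].
have out w : w \in G -> w \notin T -> coset T w = z.
  move=> Gw Tw; apply/set1P; rewrite -Dz !inE mem_quotient // andbT.
  by apply: contra Tw => /eqP/coset_idr->; rewrite ?nT.
apply: coset_idr; rewrite ?nT ?groupM // morphM ?nT //= (out y) //.
by rewrite -[x]invgK morphV ?nT ?groupV //= out ?groupV ?mulVg.
Qed.

End MaximalSubgroup.

(** That [~ g, x, x] = 1 for all g means that x commutes with its conjugates.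
    Depending on the parity of p, one of the two preceding lemmas applies to
    G / 'L_4(G) or to G / 'L_5(G) and shows that the series stops there. *)
Lemma engel2_lcn4 (gT : finGroupType) (p : nat) (G T : {group gT}) :
  prime p -> p.-group G -> maximal T G -> engel2_outside G T -> 'L_4(G) = 1.
Proof.
move=> pr_p pG maxT eng; have prTG := max_proper maxT.
have sG'T := max_der1 pr_p pG maxT; have nilG := pgroup_nil pG.
have sLT n : 'L_n.+2(G) \subset T.
  exact: subset_trans (lcn_sub_leq G (isT : 2 <= n.+2)) sG'T.
have nLG n : 'L_n(G)%G <| G := lcn_normal n G.
have L0 n : 'L_n(G / 'L_n(G)) = 1 by rewrite -quotient_lcn // trivg_quotient.
have prQ n := quotient_outside (nLG n.+2) (sLT n) prTG.
have pQ n := quotient_pgroup 'L_n(G) pG.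
have eQ n := engel2_quotient eng (nLG n.+2) (sLT n).
have [p2|oddp] := even_prime pr_p.
  apply/trivgP; apply: subset_trans (lcn_subS 3 G) _.
  rewrite (lcn_stable_quotient (n := 2) nilG) //.
  apply: (engel2_two_lcn4 (pQ 4) (prQ 2) (eQ 2) p2 _ (L0 4)).
  have maxQ : maximal (T / 'L_4(G)) (G / 'L_4(G)).
    by rewrite quotient_maximal // (normalS (sLT 2) (proper_sub prTG)).
  exact: (max_mul_outside (pQ 4) maxQ p2).
apply: (lcn_stable_quotient (n := 3) nilG); apply/eqP.
rewrite (ucn_lcnP 3) eqEsubset ucn_sub /=; apply/subsetP=> x Qx.
apply: mem_ucnS => // y Qy; apply: mem_ucnS; first exact: groupR.
move=> z Qz; apply: mem_ucnS => [|w Qw]; first by rewrite !groupR.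
have sQ' : (G / 'L_5(G))^`(1) \subset T / 'L_5(G).
  by rewrite -quotient_der ?lcn_norm // quotientS.
by apply/set1P; apply: (engel2_odd_lcn5 (pQ 5) (prQ 3) sQ' (eQ 3) oddp (L0 5)).
Qed.

(** * Three-Engel elements outside a subgroup *)

Section Trilinear.

Variables (gT : finGroupType) (p : nat) (G T Z : {group gT}).
Variable F : gT -> gT -> gT -> gT.
Hypotheses (pZ : p.-group Z) (cZ : abelian Z) (prTG : T \proper G).
Hypothesis FZ : {in G & &, forall x y z, F x y z \in Z}.
Hypothesis FM : {in G & G, forall x x',
  {in G &, forall y z, F (x * x') y z = F x y z * F x' y z}}.
Hypothesis F12 : {in G & &, forall x y z, F y x z = F x y z}.
Hypothesis F23 : {in G & &, forall x y z, F x z y = F x y z}.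
Hypothesis co6 : coprime p 6.

Let cZm x y : x \in Z -> y \in Z -> x * y = y * x.
Proof. by move=> Zx Zy; apply: (centsP cZ). Qed.

Let FM2 : {in G & G, forall x x',
  {in G &, forall y z, F y (x * x') z = F y x z * F y x' z}}.
Proof. by move=> x x' Gx Gx' y z Gy Gz; rewrite !(F12 _ Gy) ?groupM // FM. Qed.

Let FM3 : {in G & G, forall x x',
  {in G &, forall y z, F y z (x * x') = F y z x * F y z x'}}.
Proof.
by move=> x x' Gx Gx' y z Gy Gz; rewrite !(F23 Gy _ Gz) ?groupM // FM2.
Qed.

Let FV x y z : x \in G -> y \in G -> z \in G -> F x^-1 y z = (F x y z)^-1.
Proof.
move=> Gx Gy Gz; apply: (mulgI (F x y z)); rewrite -FM ?groupV // !mulgV.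
by apply: (mulgI (F 1 y z)); rewrite -FM ?mulg1.
Qed.

Let FV3 x y z : x \in G -> y \in G -> z \in G -> F x y z^-1 = (F x y z)^-1.
Proof.
move=> Gx Gy Gz; have GVz : z^-1 \in G by rewrite groupV.
by rewrite (F23 Gx GVz Gy) (F12 GVz Gx Gy) FV // (F12 Gx Gz Gy) (F23 Gx Gy Gz).
Qed.

Lemma cubic_sq w x y : w \in G -> x \in G -> y \in G ->
  F w (x * y) (x * y) = F w x x * F w y y * F w x y ^+ 2.
Proof.
move=> Gw Gx Gy; rewrite FM2 ?groupM // !FM3 // (F23 Gw Gx Gy) -!mulgA.
rewrite expgS expg1.
by congr (_ * _); rewrite !mulgA cZm ?groupM ?FZ // mulgA.
Qed.

Lemma cubicM x y : x \in G -> y \in G ->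
  F (x * y) (x * y) (x * y) =
    F x x x * F y y y * F x x y ^+ 3 * F x y y ^+ 3.
Proof.
move=> Gx Gy; rewrite FM ?groupM // !cubic_sq //.
rewrite (F12 Gx Gy Gy) (F12 Gx Gy Gx) (F23 Gx Gx Gy).
have [Zq ZQ] := (FZ Gx Gx Gx, FZ Gy Gy Gy).
have [ZA ZB] := (FZ Gx Gx Gy, FZ Gx Gy Gy).
move: (F x x x) (F y y y) (F x x y) (F x y y) Zq ZQ ZA ZB.
move=> q Q A B Zq ZQ ZA ZB.
rewrite -!mulgA; congr (_ * _); rewrite (cZm ZB) ?groupM ?groupX //.
rewrite [RHS](cZm ZQ) ?groupM ?groupX // -!mulgA.
by do 3!congr (_ * _); rewrite (cZm ZQ) ?groupM // -!mulgA.
Qed.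

(** Multiplying the expansions of the cubic form at x * y and x * y^-1 leaves
    only the sixth power of F x y y. *)
Lemma cubic_polar x y : x \in G -> y \in G ->
  F x x x = 1 -> F (x * y) (x * y) (x * y) = 1 ->
  F (x * y^-1) (x * y^-1) (x * y^-1) = 1 -> F x y y = 1.
Proof.
move=> Gx Gy Fx; have GVy : y^-1 \in G by rewrite groupV.
have FQ : F y^-1 y^-1 y^-1 = (F y y y)^-1.
  by rewrite FV3 // FV // (F12 GVy Gy Gy) FV // !invgK.
have FB : F x y^-1 y^-1 = F x y y.
  by rewrite FV3 // (F12 GVy Gx Gy) FV // invgK (F12 Gx Gy Gy).
rewrite !cubicM // Fx !mul1g FQ FB FV3 // => e1 e2.
have [ZQ ZA ZB] := And3 (FZ Gy Gy Gy) (FZ Gx Gx Gy) (FZ Gx Gy Gy).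
apply: (p_elt_expg1 pZ ZB co6).
move: (F y y y) (F x x y) (F x y y) ZQ ZA ZB e1 e2 => Q A B ZQ ZA ZB.
rewrite expgVn -invMg (cZm (groupX 3 ZA) ZQ); set C := Q * A ^+ 3 => e1 e2.
have ZC : C \in Z by rewrite groupM ?groupX.
have -> : B ^+ 6 = B ^+ 3 * B ^+ 3 by rewrite -expgD.
by rewrite -[X in X * _](mulKg C) e1 mulg1 e2.
Qed.

(** By [cubic_polar], F x t t = 1 for x outside T and t in T.  As x * t is also
    outside T, this implies F t t t = 1, so that the cubic form vanishes on all
    of G and can be polarized twice. *)
Lemma trilinear_of_cubic :
  {in G, forall x, x \notin T -> F x x x = 1} ->
  {in G & &, forall x y z, F x y z = 1}.
Proof.
move=> F0; have co2 : coprime p 2.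
  by have := co6; rewrite (coprimeMr p 2 3) => /andP[].
have out x t : x \in G -> t \in G -> x \notin T -> t \in T -> F x t t = 1.
  move=> Gx Gt Tx Tt.
  have [GVt TVt] : t^-1 \in G /\ t^-1 \in T by rewrite !groupV.
  by apply: cubic_polar; rewrite ?F0 ?(groupMr x Tt) ?(groupMr x TVt) ?groupM.
have [u Gu Tu] := exists_outside prTG.
have cub t : t \in G -> F t t t = 1.
  move=> Gt; have [Tt|] := boolP (t \in T); last exact: F0.
  by rewrite -[LHS]mul1g -{1}(out u t) // -FM // out ?groupMr // groupM.
have alt x y : x \in G -> y \in G -> F x y y = 1.
  by move=> Gx Gy; apply: cubic_polar; rewrite ?cub ?groupM ?groupV.
move=> x y z Gx Gy Gz; apply: (p_elt_expg1 pZ (FZ Gx Gy Gz) co2).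
by have := alt x (y * z) Gx (groupM Gy Gz); rewrite cubic_sq // !alt // !mul1g.
Qed.

End Trilinear.

Section ThreeEngelClass.

Variables (gT : finGroupType) (p : nat) (G T : {group gT}).
Hypotheses (pG : p.-group G) (prTG : T \proper G) (co6 : coprime p 6).
Hypothesis cL4 : G^`(1) \subset 'C('L_4(G)).
Hypothesis eng : {in 'L_4(G) & G, forall a x, x \notin T -> [~ a, x, x, x] = 1}.

(** As G' centralizes 'L_4(G), entries after the first of [~ a, x, y, z], with
    a in 'L_4(G), may be permuted; modulo 'L_8(G) this commutator is thus a
    symmetric trilinear form whose cubic form vanishes outside T. *)
Lemma engel3_lcn8 : 'L_8(G) = 1 -> 'L_7(G) = 1.
Proof.
move=> L8; pose F a x y z := lnormed a [:: x; y; z] : gT.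
have cR u x y : u \in 'L_4(G) -> x \in G -> y \in G -> [~ u, [~ x, y]] = 1.
  move=> Lu Gx Gy; apply/eqP/commgP/esym.
  by apply: (centP (subsetP cL4 _ (mem_commg Gx Gy))).
have F0 a : a \in 'L_4(G) -> {in G & &, forall x y z, F a x y z = 1}.
  move=> La; have Ga := mem_lcnG La.
  have cL7 : abelian 'L_7(G).
    by apply/centsP=> x Lx y Ly; apply: lcn_last_cent L8 Lx (mem_lcnG Ly).
  apply: (@trilinear_of_cubic _ p G T 'L_7(G)%G) => //.
  - exact: pgroupS (lcn_sub 7 G) pG.
  - by move=> x y z Gx Gy Gz; apply: (lnormed_lcn La); rewrite /= Gx Gy Gz.
  - move=> x x' Gx Gx' y z Gy Gz.
    by apply: (@lnormedM _ G 4 a x x' [::] [:: y; z]); rewrite //= Gy Gz.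
  - move=> x y z Gx Gy Gz; have := eqlcn_Jacobi La Gx Gy.
    rewrite cR // mul1g => /(eqlcn_commg (groupR (groupR Ga Gy) Gx) Gz).
    by move/(eqlcn1 L8)/esym.
  - move=> x y z Gx Gy Gz; have La1 := mem_lcnS La Gx.
    have := eqlcn_Jacobi La1 Gy Gz.
    by rewrite cR ?mul1g ?(subsetP (lcn_subS 4 G)) // => /(eqlcn1 L8)/esym.
  by move=> x Gx Tx; apply: eng.
have sLZ : 'L_4(G) \subset 'Z_3(G).
  apply/subsetP=> a La; have Ga := mem_lcnG La.
  apply: mem_ucnS => // x Gx; apply: mem_ucnS; first exact: groupR.
  move=> y Gy; apply: mem_ucnS => [|z Gz]; first by rewrite !groupR.
  by apply/set1P; apply: F0.
have step n m : 'L_n.+1(G) \subset 'Z_m.+1(G) -> 'L_n.+2(G) \subset 'Z_m(G).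
  by move=> sLZm; apply: subset_trans (commSg _ sLZm) (ucn_comm _ _).
by apply/trivgP; exact: (step 5 0 (step 4 1%N (step 3 2 sLZ))).
Qed.

End ThreeEngelClass.

Lemma engel3_lcn7 (gT : finGroupType) (p : nat) (G T : {group gT}) :
  p.-group G -> T \proper G -> G^`(1) \subset T -> coprime p 6 ->
  G^`(1) \subset 'C('L_4(G)) ->
  {in 'L_4(G) & G, forall a x, x \notin T -> [~ a, x, x, x] = 1} ->
  'L_7(G) = 1.
Proof.
move=> pG prTG sG'T co6 cL4 eng; apply: lcn_stable_quotient (pgroup_nil pG) _.
have nLG : 'L_8(G) <| G := lcn_normal 8 G.
have sLT : 'L_8(G) \subset T.
  exact: subset_trans (lcn_sub_leq G (isT : 2 <= 8)) sG'T.
apply: (engel3_lcn8 (quotient_pgroup _ pG) (quotient_outside nLG sLT prTG) co6).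
- by rewrite -quotient_lcn // -quotient_der ?normal_norm // quotient_cents.
- move=> A X; rewrite -quotient_lcn // => /morphimP[a Na La ->{A}] GX nTX.
  have [x [Gx Nx nTx ->]] := lift_outside sLT GX nTX.
  by rewrite -!morphR ?groupR // (eng a x) // morph1.
by rewrite -quotient_lcn // trivg_quotient.
Qed.

(** * Cyclic subgroups of p-groups *)

Section CyclicPGroups.

Variables (gT : finGroupType) (p : nat).
Implicit Types x y u v : gT.

Lemma p_elt_cycle_total x u v : p.-elt x -> u \in <[x]> -> v \in <[x]> ->
  (u \in <[v]>) || (v \in <[u]>).
Proof.
move=> px xu xv; rewrite -!cycle_subG.
have cx := cycle_cyclic x; rewrite -cycle_subG in xu; rewrite -cycle_subG in xv.
rewrite -(cardSg_cyclic cx xu xv) -(cardSg_cyclic cx xv xu).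
have [[i ->] [j ->]] := (p_natP (pgroupS xu px), p_natP (pgroupS xv px)).
by case/orP: (leq_total i j) => /(dvdn_exp2l p) ->; rewrite ?orbT.
Qed.

Lemma cycle_expg_coprime v k : coprime #[v] k -> v \in <[v ^+ k]>.
Proof. by rewrite -generator_coprime => /eqP <-; apply: cycle_id. Qed.

(** The subgroups of <[x]> form a chain, in which <[v ^+ p]> is the maximal
    subgroup of <[v]>. *)
Lemma p_elt_cycle_expgp x u v : prime p -> p.-elt x ->
  u \in <[x]> -> v \in <[x]> -> v \notin <[u]> -> u \in <[v ^+ p]>.
Proof.
move=> pr_p px xu xv vu; have := p_elt_cycle_total px xu xv.
rewrite (negPf vu) orbF => /cycleP[k Du]; rewrite Du in vu *.
have [/dvdnP[m ->]|npk] := boolP (p %| k).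
  by rewrite mulnC expgM mem_cycle.
case/negP: vu; apply: cycle_expg_coprime.
have [n ->] := p_natP (mem_p_elt px xv).
by rewrite coprimeXl // prime_coprime.
Qed.

Lemma p_elt_notin_expgp v :
  prime p -> p.-elt v -> v != 1 -> v \notin <[v ^+ p]>.
Proof.
move=> pr_p pv v1; rewrite -cycle_subG; apply/negP=> /subset_leq_card.
rewrite -!orderE orderXgcd leqNgt ltn_Pdiv //; have [n Dv] := p_natP pv.
have n0 : 0 < n by case: n Dv => // /eqP; rewrite order_eq1 (negPf v1).
by rewrite Dv -(prednK n0) expnS gcdnC gcdnMr prime_gt1.
Qed.

Lemma cycle_eq_order x u v : u \in <[x]> -> v \in <[x]> -> #[u] = #[v] ->
  <[u]> = <[v]>.
Proof.
move=> xu xv uv; apply/eqP.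
by rewrite (eq_subG_cyclic (cycle_cyclic x)) ?cycle_subG //; apply/eqP.
Qed.

(** The automorphism group of a cyclic group is abelian. *)
Lemma norm_cycle_der1 (D : {group gT}) y :
  D \subset 'N(<[y]>) -> D^`(1) \subset 'C(<[y]>).
Proof.
move=> nD; rewrite gen_subG; apply/subsetP=> _ /imset2P[a b Da Db ->].
have NJ z w : w \in D -> z \in <[y]> -> z ^ w \in <[y]>.
  by move=> Dw yz; rewrite memJ_norm ?(subsetP nD).
have /cycleP[i Da'] := NJ y a Da (cycle_id y).
have /cycleP[j Db'] := NJ y b Db (cycle_id y).
have com z : z \in <[y]> -> z ^ (a * b) = z ^ (b * a).
  case/cycleP=> k ->; rewrite !conjXg !conjgM Da' Db' !conjXg Da' Db'.
  by rewrite (expgAC y j i).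
apply/centP=> z yz; apply/esym/commgP/conjg_fixP.
have -> : [~ a, b] = (b * a)^-1 * (a * b) by rewrite (commgC a b) mulKg.
by rewrite conjgM com ?conjgKV // NJ // groupV groupM.
Qed.

End CyclicPGroups.

(** * Normal closures of elements generating 2-subnormal subgroups *)

(** For x in G, <[x]> is 2-subnormal in G iff it is normal in the normal closure
    of x, that is, iff it is normalized by all the conjugates of x. *)
Definition baer2_elt (gT : finGroupType) (G : {set gT}) x :=
  {in G, forall g, x ^ (x ^ g) \in <[x]>}.

Section BaerElement.

Variables (gT : finGroupType) (G : {group gT}) (x : gT).
Hypotheses (Gx : x \in G) (bx : baer2_elt G x).
Local Notation N := <<x ^: G>>.

Lemma baer2_nclosure_norm h : h \in G -> N \subset 'N(<[x ^ h]>).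
Proof.
move=> Gh; rewrite gen_subG; apply/subsetP=> _ /imsetP[g Gg ->].
have Dg : (x ^ h) ^ (x ^ g) = (x ^ (x ^ (g * h^-1))) ^ h.
  by rewrite [RHS]conjJg -(conjgM x (g * _)) mulgKV.
by rewrite inE -cycleJ cycle_subG Dg /= cycleJ memJ_conjg bx ?groupM ?groupV.
Qed.

(** The closure N is generated by the conjugates x ^ h, and acts on each cyclic
    subgroup <[x ^ h]> through an abelian group. *)
Lemma baer2_nclosure_class2 : N^`(1) \subset 'C(N).
Proof.
rewrite centsC gen_subG; apply/subsetP=> _ /imsetP[h Gh ->].
by rewrite -cycle_subG centsC norm_cycle_der1 ?baer2_nclosure_norm.
Qed.

Lemma conj_mem_nclosure h : h \in G -> x ^ h \in N.
Proof. by move=> Gh; apply: mem_gen; apply: memJ_class. Qed.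

Lemma mem_nclosure : x \in N.
Proof. by have := conj_mem_nclosure (group1 G); rewrite conjg1. Qed.

Lemma nclosure_norm : G \subset 'N(N).
Proof. by rewrite norms_gen // class_norm. Qed.

Lemma nclosure_comm g : g \in G -> [~ g, x] \in N.
Proof.
move=> Gg; rewrite commgEr groupM ?mem_nclosure //.
by rewrite conjVg groupV conj_mem_nclosure.
Qed.

Lemma nclosure_cycle_comm n h :
  n \in N -> h \in G -> [~ n, x ^ h] \in <[x ^ h]>.
Proof.
move=> Nn Gh; rewrite commgEr groupM ?cycle_id //.
by rewrite memJ_norm ?groupV ?cycle_id // (subsetP (baer2_nclosure_norm Gh)).
Qed.

Lemma nclosure_comm_cent a b c : a \in N -> b \in N -> c \in N ->
  commute [~ a, b] c.
Proof.
move=> Na Nb Nc; apply: (centsP baer2_nclosure_class2) => //.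
exact: mem_commg.
Qed.

Lemma nclosure_commMg a b c : a \in N -> b \in N -> c \in N ->
  [~ a * b, c] = [~ a, c] * [~ b, c].
Proof.
move=> Na Nb Nc; rewrite commMgJ; congr (_ * _).
by apply/conjg_fixP/commgP; apply: nclosure_comm_cent.
Qed.

Lemma nclosure_commgM a b c : a \in N -> b \in N -> c \in N ->
  [~ a, b * c] = [~ a, b] * [~ a, c].
Proof.
move=> Na Nb Nc; rewrite commgMJ.
have /commgP/conjg_fixP-> := nclosure_comm_cent Na Nb Nc.
by apply: nclosure_comm_cent => //; apply: groupR.
Qed.

Lemma baer2_comm_mem g h : g \in G -> h \in G ->
  [~ x ^ g, x ^ h] \in <[x ^ g]> /\ [~ x ^ g, x ^ h] \in <[x ^ h]>.
Proof.
move=> Gg Gh; split; last exact: nclosure_cycle_comm (conj_mem_nclosure Gg) Gh.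
by rewrite -groupV invg_comm nclosure_cycle_comm ?conj_mem_nclosure.
Qed.

(** [~ g, x] lies in the closure N, which normalizes <[x]>, so [~ g, x, x] is
    a power of x. *)
Lemma baer2_engel3 g : g \in G -> [~ g, x, x, x] = 1.
Proof.
move=> Gg; apply/eqP/commgP.
have := nclosure_cycle_comm (nclosure_comm Gg) (group1 G).
by rewrite conjg1 => /cycleP[k ->]; apply/commute_sym/commuteX.
Qed.

End BaerElement.

(** * The cyclic subgroup generated by a commutator of two conjugates *)

Section BaerComm.

Variables (gT : finGroupType) (p : nat) (G T : {group gT}) (x c : gT).
Hypotheses (pr_p : prime p) (pG : p.-group G).
Hypotheses (Gx : x \in G) (bx : baer2_elt G x) (Gc : c \in G).
Local Notation N := <<x ^: G>>.
Let v := [~ x, x ^ c].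
Local Notation C := 'N(<[v]>).
Local Notation S := <[v ^+ p]>.

Let pelt y : y \in G -> p.-elt y.
Proof. exact: mem_p_elt pG. Qed.

Let v_x : v \in <[x]>.
Proof.
by have [+ _] := baer2_comm_mem bx (group1 G) Gc; rewrite conjg1.
Qed.

Let v_xc : v \in <[x ^ c]>.
Proof.
by rewrite /v -{1}[x]conjg1; have [] := baer2_comm_mem bx (group1 G) Gc.
Qed.

Let sub_x u : u \in <[x]> -> u \in G.
Proof. by apply: subsetP; rewrite cycle_subG. Qed.

Lemma comm_norm h u : h \in G -> u \in <[v]> -> u \in <[x ^ h]> ->
  h \in 'N(<[u]>).
Proof.
move=> Gh vu xhu; have xu : u \in <[x]>.
  by apply: subsetP vu; rewrite cycle_subG.
rewrite inE -cycleJ (@cycle_eq_order _ (x ^ h) (u ^ h) u) ?orderJ //.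
by rewrite /= cycleJ memJ_conjg.
Qed.

(** If h does not normalize <[v]>, then <[x]> and <[x ^ h]> meet in a subgroup
    that does not contain v: otherwise v and v ^ h would generate subgroups of
    the same order of the cyclic group <[x ^ h]>.  In particular
    [~ x, x ^ h] is then a p-th power of v, negligible with respect to v. *)
Lemma comm_small h u : h \in G -> h \notin C ->
  u \in <[x]> -> u \in <[x ^ h]> -> u \in S.
Proof.
move=> Gh nCh xu xhu; apply: (p_elt_cycle_expgp pr_p (pelt Gx)) => //.
apply: contra nCh => uv; apply: comm_norm => //; first exact: cycle_id.
by apply: subsetP uv; rewrite cycle_subG.
Qed.

Lemma comm_small2 g h u : g \in G -> h \in G -> h * g^-1 \notin C ->
  u \in <[x ^ g]> -> u \in <[x ^ h]> -> u ^ g^-1 \in S.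
Proof.
move=> Gg Gh nC xgu xhu; have Ghg : h * g^-1 \in G by rewrite groupM ?groupV.
apply: comm_small Ghg nC _ _; first by rewrite -mem_conjg -cycleJ.
by rewrite -mem_conjg -cycleJ -conjgM mulgKV.
Qed.

Lemma comm_normc : c \in C.
Proof. by apply: comm_norm v_xc; rewrite ?cycle_id. Qed.

Lemma comm_notin : v != 1 -> v \notin S.
Proof. by apply: p_elt_notin_expgp => //; apply/pelt/sub_x. Qed.

Lemma nclosure_expMg a b l : a \in N -> b \in N ->
  (a * b) ^+ l = a ^+ l * b ^+ l * [~ b, a] ^+ 'C(l, 2).
Proof.
move=> Na Nb; apply: expMg_Rmul; apply: commute_sym.
  exact: (nclosure_comm_cent bx).
exact: (nclosure_comm_cent bx).
Qed.

Hypotheses (sG'T : G^`(1) \subset T) (Tx : x \notin T).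
Hypothesis bT : {in G, forall y, y \notin T -> baer2_elt G y}.

Lemma mul_conj_outside k g : coprime p k.+1 -> g \in G ->
  x * (x ^ g) ^+ k \notin T.
Proof.
move=> co Gg; have Gxk := groupX k Gx.
rewrite -conjXg conjg_mulR mulgA -expgS groupMr; last first.
  by apply: subsetP sG'T _ _; rewrite mem_commg.
apply: contra Tx; rewrite -cycle_subG => /subsetP/(_ x); apply.
apply: cycle_expg_coprime; have [n ->] := p_natP (pelt Gx).
exact: coprimeXl.
Qed.

(** Suppose that g does not normalize <[v]>, and let b = x ^ (c * g).  The
    conjugate of y = x * b by g^-1 is x ^ g^-1 * x ^ c, and among the four
    commutators of the factors of y with these two, only v = [~ x, x ^ c] is
    not negligible: the others involve conjugates of x by elements in distinct
    cosets of C, for which p odd is needed since g ^+ 2 must be outside C.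
    As y is outside T, its commutator with y ^ g^-1 is a power of y, say y ^+ l.
    Comparing the components in <[x]> and in <[b]>, x ^+ l is v up to a
    negligible factor, whereas b ^+ l, hence also x ^+ l, is negligible. *)
Lemma comm_normal_odd : odd p -> G \subset C.
Proof.
move=> oddp; have [v1|vn1] := eqVneq v 1.
  by rewrite v1 cycle1 norm1 subsetT.
apply/subsetP=> g Gg; apply: contraR (comm_notin vn1) => nCg.
have Cc := comm_normc; have GVg : g^-1 \in G by rewrite groupV.
have Gcg := groupM Gc Gg; pose b := x ^ (c * g); pose d := x ^ g^-1.
have ngC : g^-1 \notin C by rewrite groupV.
have ncgC : c * g \notin C by rewrite groupMl.
have [Nx Nb Nd Nxc] : [/\ x \in N, b \in N, d \in N & x ^ c \in N].
  by rewrite mem_nclosure !conj_mem_nclosure.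
pose y := x * b.
have Gy : y \in G by rewrite groupM ?groupJ.
have Ty : y \notin T.
  by have := @mul_conj_outside 1 (c * g) _ Gcg; rewrite expg1 coprimen2; apply.
have [l Dw] : exists l, [~ y, y ^ g^-1] = y ^+ l.
  apply/cycleP; have := baer2_comm_mem (bT Gy Ty) (group1 G) GVg.
  by rewrite conjg1 => -[].
have yd : y ^ g^-1 = d * x ^ c by rewrite conjMg -conjgM mulgK.
rewrite yd (nclosure_expMg l Nx Nb) in Dw.
rewrite (nclosure_commMg bx Nx Nb (groupM Nd Nxc)) in Dw.
rewrite (nclosure_commgM bx Nx Nd Nxc) (nclosure_commgM bx Nb Nd Nxc) in Dw.
have [e1x e1d] := baer2_comm_mem bx (group1 G) GVg.
have [e2x e2d] := baer2_comm_mem bx Gcg GVg.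
have [e3x e3d] := baer2_comm_mem bx Gcg Gc.
rewrite conjg1 -!/b -!/d in e1x e1d e2x e2d e3x e3d.
have [sb sx] := baer2_comm_mem bx Gcg (group1 G).
rewrite conjg1 -!/b in sb sx.
have toS h u : h \in G -> h * (c * g)^-1 \notin C ->
    u \in <[b]> -> u \in <[x ^ h]> -> u ^ (c * g)^-1 \in S.
  by move=> Gh nC bu; apply: comm_small2.
have ng2C : g ^+ 2 \notin C.
  apply: contra nCg => g2C; rewrite -cycle_subG in g2C.
  apply: subsetP g2C _ (cycle_expg_coprime _).
  have [n ->] := p_natP (mem_p_elt pG Gg).
  by rewrite coprimeXl // coprimen2.
set s := _ ^+ 'C(l, 2) in Dw; set f := _ * [~ b, x ^ c] in Dw.
(* Separate Dw into components: u is in <[x]> by this definition, and in <[b]>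
   by Du. *)
pose u := x ^- l * ([~ x, d] * v).
have Du : u = b ^+ l * s * f^-1.
  by apply: (canRL (mulgK f)); rewrite /u -mulgA Dw -mulgA mulKg.
have ux : u \in <[x]> := groupM (groupVr (mem_cycle x l)) (groupM e1x v_x).
have fb : f \in <[b]> := groupM e2x e3x.
have sb' : s \in <[b]> := groupX _ sb.
have ub : u \in <[b]>.
  by rewrite Du; apply: groupM (groupM (mem_cycle b l) sb') (groupVr fb).
have n1C : 1 * (c * g)^-1 \notin C by rewrite mul1g groupV.
have uS := comm_small Gcg ncgC ux ub.
have e1S := comm_small GVg ngC e1x e1d.
have u'S : u ^ (c * g)^-1 \in S by apply: (toS 1) => //; rewrite ?conjg1.
have s'S : s ^ (c * g)^-1 \in S.
  by apply: (toS 1) => //; rewrite ?conjg1 groupX.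
have f'S : f ^ (c * g)^-1 \in S.
  rewrite conjMg groupM //; first apply: (toS g^-1) => //.
    by rewrite invMg mulgA groupMr ?groupV // -invMg groupV.
  apply: (toS c) => //.
  by rewrite invMg mulgA groupMr ?groupV // groupMl // groupV.
have xlS : x ^+ l \in S.
  have -> : x ^+ l = (u * f * s^-1) ^ (c * g)^-1.
    by rewrite Du mulgKV mulgK conjXg conjgK.
  rewrite (conjMg (u * f)) (conjMg u f) conjVg.
  exact: groupM (groupM u'S f'S) (groupVr s'S).
have Dv : v = [~ x, d]^-1 * (x ^+ l * u) by rewrite mulKVg mulKg.
rewrite [X in X \in _]Dv; exact: groupM (groupVr e1S) (groupM xlS uS).
Qed.

(** For p = 2 the product of two conjugates of x lies in T, but x * b ^+ 2,
    where b = x ^ g, does not.  Its commutator with its conjugate by c has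
    component v in <[x]>, up to negligible factors, and a fourth power, up to
    squares of negligible elements, in <[b]>.  As this commutator is
    x ^+ l * b ^+ 2 ^+ l up to a factor in both <[x]> and <[b]>, <[x]> and
    <[b]> share an element u for which u ^ g^-1 is the square of a generator
    of <[v]>; hence g normalizes <[v ^+ 2]>.  Here v is chosen of maximal
    order, so that [~ b, x ^ (g * c)] is a power of v ^ g. *)
Lemma comm_sqr_normal : p = 2 -> {in G, forall h, [~ x, x ^ h] \in <[v]>} ->
  G \subset 'N(<[v ^+ 2]>).
Proof.
move=> p2 vmax; have [v1|vn1] := eqVneq v 1.
  by rewrite v1 expg1n cycle1 norm1 subsetT.
apply/subsetP=> g Gg; have [Cg|nCg] := boolP (g \in C).
  apply: subsetP Cg; apply: char_norms.
  rewrite sub_cyclic_char ?cycle_cyclic //.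
  by rewrite cycle_subG mem_cycle.
have Cc := comm_normc; have Ggc := groupM Gg Gc.
have GVg : g^-1 \in G by rewrite groupV.
pose b := x ^ g; pose d := x ^ (g * c).
have ngcC : g * c \notin C by rewrite groupMr.
have [Nx Nb Nd Nxc] : [/\ x \in N, b \in N, d \in N & x ^ c \in N].
  by rewrite mem_nclosure !conj_mem_nclosure.
have [Nb2 Nd2] := (groupX 2 Nb, groupX 2 Nd).
pose y := x * b ^+ 2.
have Gy : y \in G by apply: groupM (groupX _ (groupJ _ _)).
have Ty : y \notin T by apply: mul_conj_outside; rewrite ?p2.
have [l Dw] : exists l, [~ y, y ^ c] = y ^+ l.
  apply/cycleP; have := baer2_comm_mem (bT Gy Ty) (group1 G) Gc.
  by rewrite conjg1 => -[].
have yc : y ^ c = x ^ c * d ^+ 2 by rewrite conjMg conjXg -conjgM.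
rewrite yc (nclosure_expMg l Nx Nb2) in Dw.
rewrite (nclosure_commMg bx Nx Nb2 (groupM Nxc Nd2)) in Dw.
rewrite (nclosure_commgM bx Nx Nxc Nd2) (nclosure_commgM bx Nb2 Nxc Nd2) in Dw.
have cN a b' e : a \in N -> b' \in N -> e \in N -> commute e [~ a, b'].
  by move=> Na Nb' Ne; apply/commute_sym/(nclosure_comm_cent bx).
rewrite (commgX _ (cN _ _ _ Nx Nd Nd)) !(commXg _ (cN _ _ _ Nb Nx Nb)) in Dw.
rewrite (commXg _ (cN _ _ _ Nb Nxc Nb)) in Dw.
rewrite (commXXg _ _ (cN _ _ _ Nb Nd Nb) (cN _ _ _ Nb Nd Nd)) in Dw.
rewrite (expgAC b) (expgAC _ 2) -[(2 * 2)%N]/4 in Dw.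
have [e1x e1d] := baer2_comm_mem bx (group1 G) Ggc.
have [e2b e2x] := baer2_comm_mem bx Gg Gc.
have [e3b _] := baer2_comm_mem bx Gg Ggc.
have [sb sx] := baer2_comm_mem bx Gg (group1 G).
rewrite conjg1 -!/b -!/d in e1x e1d e2b e2x e3b sb sx.
rewrite -/v in Dw.
have toS h u : h \in G -> h * g^-1 \notin C ->
    u \in <[b]> -> u \in <[x ^ h]> -> u ^ g^-1 \in S.
  by move=> Gh nC bu; apply: comm_small2.
have toX u : u \in <[b]> -> u ^ g^-1 \in <[x]>.
  by rewrite -mem_conjg -cycleJ.
set e1 := [~ x, d] in Dw e1x e1d; set e2 := [~ b, x ^ c] in Dw e2b e2x.
set e3 := [~ b, d] in Dw e3b; set s := _ ^+ 'C(l, 2) in Dw.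
have sb' : s \in <[b]> := groupX _ sb.
have sx' : s \in <[x]> := groupX _ sx.
pose f := e2 ^+ 2 * e3 ^+ 4; pose u := x ^- l * (v * e1 ^+ 2).
have fb : f \in <[b]> by apply: groupM; apply: groupX.
have Du : u = b ^+ l ^+ 2 * s ^+ 2 * f^-1.
  by apply: (canRL (mulgK f)); rewrite /u -mulgA Dw -mulgA mulKg.
have ux : u \in <[x]>.
  exact: groupM (groupVr (mem_cycle x l)) (groupM v_x (groupX 2 e1x)).
have ub : u \in <[b]>.
  rewrite Du; apply: groupM (groupVr fb); apply: groupM (groupX 2 sb').
  by rewrite -expgM mem_cycle.
have uS := comm_small Gg nCg ux ub.
have e1S := comm_small Ggc ngcC e1x e1d.
have n1C : 1 * g^-1 \notin C by rewrite mul1g groupV.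
have s'S : s ^ g^-1 \in S by apply: (toS 1) => //; rewrite conjg1.
have e2'S : e2 ^ g^-1 \in S by apply: (toS c) => //; rewrite groupMl ?groupV.
have e3'S : (e3 ^ g^-1) ^+ 2 \in S.
  have : e3 ^ g^-1 \in <[v]>.
    rewrite /e3 /b /d conjRg -!conjgM mulgV conjg1; apply: vmax.
    exact: groupM Ggc GVg.
  by case/cycleP=> k ->; rewrite expgAC -p2 mem_cycle.
(* Conjugation by g^-1 moves u from <[b]> to <[x]>, where squares can be
   collected: u ^ g^-1 becomes the square of x ^+ l * r, with r negligible. *)
pose r := s ^ g^-1 * (e2 ^ g^-1 * (e3 ^ g^-1) ^+ 2)^-1.
have rS : r \in S := groupM s'S (groupVr (groupM e2'S e3'S)).
have sSx : {subset S <= <[x]>}.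
  by apply/subsetP; rewrite cycle_subG groupX.
have cx a a' : a \in <[x]> -> a' \in <[x]> -> commute a a'.
  by move=> xa xa'; apply: (centsP (cycle_abelian x)).
have xlx := mem_cycle x l; have rx := sSx r rS.
have [s'x e2'x e3'x] := And3 (toX s sb') (toX e2 e2b) (toX e3 e3b).
have Dt : u ^ g^-1 = (x ^+ l * r) ^+ 2.
  rewrite Du (conjMg _ f^-1) (conjMg _ (s ^+ 2)) conjVg (conjMg (e2 ^+ 2)).
  rewrite !conjXg conjgK (expgMn _ (cx _ _ xlx rx)) /r.
  rewrite (expgMn _ (cx _ _ s'x _)) ?groupV ?expgVn; last first.
    by apply: groupM (groupX 2 _).
  rewrite (expgMn _ (cx _ _ e2'x _)) ?groupX //.
  by rewrite /s conjXg -(expgM (e3 ^ g^-1)) -mulgA.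
have vr : x ^+ l * r \notin S.
  rewrite groupMr //; apply: contra (comm_notin vn1) => xlS.
  have Dv : v = x ^+ l * u * (e1 ^+ 2)^-1.
    by rewrite /u (mulKVg (x ^+ l)) (mulgK (e1 ^+ 2) v).
  rewrite [X in X \in _]Dv.
  exact: groupM (groupM xlS uS) (groupVr (groupX 2 e1S)).
have : v \in <[x ^+ l * r]>.
  apply: contraR vr => nv; apply: (p_elt_cycle_expgp pr_p (pelt Gx) _ v_x nv).
  exact: groupM.
case/cycleP=> m Dm; rewrite -groupV; apply: comm_norm => //.
  exact: mem_cycle.
rewrite [in X in X \in _]Dm -expgM mulnC expgM -Dt; apply: groupX.
by rewrite /= cycleJ memJ_conjg.
Qed.

End BaerComm.

(** * Finite p-groups with 2-subnormal cyclic subgroups outside T *)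

Section FiniteBaer.

Variables (gT : finGroupType) (p : nat) (G T : {group gT}).
Hypotheses (pr_p : prime p) (pG : p.-group G) (maxT : maximal T G).

Lemma lcn4_sub_of_comm (M : {group gT}) : M <| G -> M \subset T ->
  (forall x h, x \in G -> x \notin T -> h \in G -> [~ x, x ^ h] \in M) ->
  'L_4(G) \subset M.
Proof.
move=> nMG sMT cM; have nM := normal_norm nMG.
have sTG := proper_sub (max_proper maxT).
have maxQ : maximal (T / M) (G / M).
  by rewrite quotient_maximal // (normalS sMT sTG).
have eng : engel2_outside (G / M) (T / M).
  move=> _ X /morphimP[a Na Ga ->] GX nTX.
  have [x [Gx Nx nTx ->]] := lift_outside sMT GX nTX.
  have com : commute (coset M x) (coset M x ^ coset M a).
    by apply/commgP; rewrite -morphJ // -morphR ?groupJ //= coset_id ?cM.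
  apply/eqP/commgP; rewrite commgEr conjVg; apply: commute_sym.
  exact: commuteM (commuteV com) (commute_refl _).
have := engel2_lcn4 pr_p (quotient_pgroup M pG) maxQ eng.
rewrite -quotient_lcn // => /trivgP; rewrite quotient_sub1 //.
exact: subset_trans (lcn_sub 4 G) nM.
Qed.

Lemma der2_sub_lcn4 : G^`(2) \subset 'L_4(G).
Proof. exact: (lcn_comm2 G 2). Qed.

Lemma center_der1_normal : 'Z(G^`(1)) <| G.
Proof. exact: gFnormal_trans (der_normal 1 G). Qed.

Lemma center_der1_sub : 'Z(G^`(1)) \subset T.
Proof. exact: subset_trans (center_sub _) (max_der1 pr_p pG maxT). Qed.

Hypothesis bT : {in G, forall y, y \notin T -> baer2_elt G y}.

(** G normalizes the cyclic subgroup generated by [~ x, x ^ h], so that G'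
    centralizes it. *)
Lemma comm_in_center_odd x h : odd p -> x \in G -> x \notin T -> h \in G ->
  [~ x, x ^ h] \in 'Z(G^`(1)).
Proof.
move=> oddp Gx Tx Gh; set v := [~ x, _].
have sG'T := max_der1 pr_p pG maxT.
have nv := comm_normal_odd pr_p pG Gx (bT Gx Tx) Gh sG'T Tx bT oddp.
rewrite inE mem_commg ?groupJ //= -cycle_subG centsC.
exact: norm_cycle_der1.
Qed.

Lemma lcn4_center_odd : odd p -> 'L_4(G) \subset 'Z(G^`(1)).
Proof.
move=> oddp; apply: lcn4_sub_of_comm center_der1_normal center_der1_sub _.
by move=> x h *; apply: comm_in_center_odd.
Qed.

Lemma baer2_lcn7 : 3 < p -> 'L_7(G) = 1.
Proof.
move=> p3; have oddp : odd p.
  by case: (even_prime pr_p) => // p2; rewrite p2 in p3.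
have sLZ := lcn4_center_odd oddp.
apply: (engel3_lcn7 pG (max_proper maxT) (max_der1 pr_p pG maxT)).
- rewrite (coprimeMr p 2 3) coprimen2 oddp /= coprime_sym prime_coprime //.
  by rewrite dvdn_prime2 //; apply: contraL p3 => /eqP <-.
- by rewrite centsC; apply: subset_trans sLZ (subsetIr _ _).
by move=> a x /mem_lcnG Ga Gx Tx; exact: (baer2_engel3 (bT Gx Tx) Ga).
Qed.

Lemma baer2_comm_sqr x h : p = 2 -> x \in G -> x \notin T -> h \in G ->
  [~ x, x ^ h] ^+ 2 \in 'Z(G^`(1)).
Proof.
move=> p2 Gx Tx Gh.
have bx := bT Gx Tx.
pose ord k := #[ [~ x, x ^ k] ].
have [c Gc cmax] : exists2 c, c \in G & {in G, forall k, ord k <= ord c}.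
  by case: (@arg_maxnP _ 1 (mem G) ord (group1 G)) => c Gc cmax; exists c.
set v := [~ x, x ^ c].
have vx k : k \in G -> [~ x, x ^ k] \in <[x]>.
  by move=> Gk; have [+ _] := baer2_comm_mem bx (group1 G) Gk; rewrite conjg1.
have px := mem_p_elt pG Gx.
have vmax : {in G, forall k, [~ x, x ^ k] \in <[v]>}.
  move=> k Gk; have /orP[//|vk] := p_elt_cycle_total px (vx k Gk) (vx c Gc).
  have : <[v]> == <[[~ x, x ^ k]]>.
    by rewrite eqEcard cycle_subG vk -!orderE cmax.
  by move/eqP->; apply: cycle_id.
have sG'T := max_der1 pr_p pG maxT.
have nv := comm_sqr_normal pr_p pG Gx bx Gc sG'T Tx bT p2 vmax.
have v2Z : v ^+ 2 \in 'Z(G^`(1)).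
  rewrite inE groupX ?mem_commg ?groupJ //= -cycle_subG centsC.
  exact: norm_cycle_der1.
by have /cycleP[k ->] := vmax h Gh; rewrite expgAC groupX.
Qed.

(** Let w = [~ x, x ^ h] and w' = [~ y, y ^ k].  The conjugates of w commute, so
    [~ w, y] is an involution, and [~ w, y ^+ 2] = [~ w, y, y] is a power of y.
    Thus w maps y ^+ 2 into <[y]>.  Now w' is a power of y ^+ 2, since an odd
    power of y would generate <[y]> and make y central in its closure.  So w
    maps w' to an involution of <[y]>, of which there is only one. *)
Lemma commute_comm_involutions x y h k : p = 2 ->
  (forall z g, z \in G -> z \notin T -> g \in G -> [~ z, z ^ g] ^+ 2 = 1) ->
  x \in G -> x \notin T -> h \in G -> y \in G -> y \notin T -> k \in G ->
  commute [~ x, x ^ h] [~ y, y ^ k].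
Proof.
move=> p2 sq Gx Tx Gh Gy Ty Gk; have [bx by_] := (bT Gx Tx, bT Gy Ty).
pose w := [~ x, x ^ h]; pose w' := [~ y, y ^ k].
rewrite -/w -/w'; have [->|nt] := eqVneq w' 1; first exact: commute1.
pose D := <<x ^: G>>^`(1).
have nDG : D <| G.
  have nNG : <<x ^: G>> <| G.
    by apply/andP; split; [rewrite gen_subG class_subG | apply: nclosure_norm].
  exact: gFnormal_trans nNG.
have cD : abelian D.
  apply: abelianS (center_abelian <<x ^: G>>).
  by rewrite subsetI der_sub baer2_nclosure_class2.
have Dw : w \in D by rewrite mem_commg ?mem_nclosure ?conj_mem_nclosure.
have Gw := subsetP (normal_sub nDG) _ Dw.
have R1 : [~ w, y] ^+ 2 = 1.
  have Dwy : w ^ y \in D by rewrite memJ_norm // (subsetP (normal_norm nDG)).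
  have w2 : w ^+ 2 = 1 := sq x h Gx Tx Gh.
  rewrite commgEl expgMn; last by apply: (centsP cD); rewrite ?groupV.
  by rewrite expgVn -conjXg w2 conj1g invg1 mulg1.
have wy2 : [~ w, y ^+ 2] = [~ w, y, y].
  by rewrite expgS expg1 commgMR (R1 : [~ w, y] * [~ w, y] = 1) mul1g.
have ywy : [~ w, y, y] \in <[y]>.
  have := nclosure_cycle_comm by_ (nclosure_comm y Gw) (group1 G).
  by rewrite conjg1.
have y2w : (y ^+ 2) ^ w \in <[y]>.
  by rewrite conjg_mulR groupM ?groupX ?cycle_id // -invg_comm groupV wy2.
have yw' : w' \in <[y]>.
  by have [+ _] := baer2_comm_mem by_ (group1 G) Gk; rewrite conjg1.
have w'2 : w' ^+ 2 = 1 := sq y k Gy Ty Gk.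
have ow' : #[w'] = 2 by apply: nt_prime_order.
have yw'w : w' ^ w \in <[y]>.
  case/cycleP: yw' => j Dw'; have [oddj|evenj] := boolP (odd j); last first.
    rewrite Dw' -(odd_double_half j) (negPf evenj) add0n -mul2n expgM conjXg.
    exact: groupX.
  case/negP: nt; apply/commgP; have : y \in 'C(<<y ^: G>>).
    have : <[w']> \subset 'C(<<y ^: G>>).
      rewrite cycle_subG (subsetP (baer2_nclosure_class2 by_)) //.
      by rewrite mem_commg ?mem_nclosure ?conj_mem_nclosure.
    move/subsetP; apply; rewrite Dw'; apply: cycle_expg_coprime.
    have [n ->] := p_natP (mem_p_elt pG Gy).
    by rewrite coprimeXl // p2 coprime2n.
  by move/centP; apply; apply: conj_mem_nclosure.
have : w' ^ w \in <[w']>.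
  by rewrite -(cycle_eq_order yw'w yw') ?orderJ ?cycle_id.
rewrite (cycle2g ow') !inE conjg_eq1 (negPf nt) /= => /eqP.
by move/conjg_fixP/commgP/commute_sym.
Qed.

End FiniteBaer.

(** The involutions [~ x, x ^ h] generate an abelian normal subgroup, modulo
    which the elements outside T commute with their conjugates. *)
Lemma baer2_involutions_der3 (gT : finGroupType) (G T : {group gT}) :
  2.-group G -> maximal T G ->
  {in G, forall y, y \notin T -> baer2_elt G y} ->
  (forall x h, x \in G -> x \notin T -> h \in G -> [~ x, x ^ h] ^+ 2 = 1) ->
  G^`(3) = 1.
Proof.
move=> pG maxT bT sq; have sG'T := max_der1 (isT : prime 2) pG maxT.
pose A := [set [~ x, x ^ h] | x in G :\: T, h in G].
have AP z : z \in A ->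
    exists x h, [/\ x \in G, x \notin T, h \in G & z = [~ x, x ^ h]].
  by case/imset2P=> x h /setDP[Gx Tx] Gh ->; exists x, h.
have sAG' : A \subset G^`(1).
  by apply/subsetP=> _ /AP[x [h [Gx Tx Gh ->]]]; rewrite mem_commg ?groupJ.
have nAG : <<A>> <| G.
  apply/andP; split.
    by rewrite gen_subG; apply: subset_trans sAG' (der_sub 1 G).
  apply: norms_gen; apply/subsetP=> g Gg; rewrite inE.
  apply/subsetP=> _ /imsetP[_ /AP[x [h [Gx Tx Gh ->]]] ->].
  rewrite conjRg -conjgM; have -> : x ^ (h * g) = (x ^ g) ^ (h ^ g).
    by rewrite -conjgM conjgE mulKVg.
  have nTG := normal_norm (p_maximal_normal pG maxT).
  apply: imset2_f; last by rewrite groupJ.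
  by apply/setDP; rewrite groupJ // memJ_norm // (subsetP nTG).
have cA : abelian <<A>>.
  rewrite abelian_gen; apply/centsP=> _ /AP[x [h [Gx Tx Gh ->]]].
  move=> _ /AP[y [k [Gy Ty Gk ->]]].
  exact: (commute_comm_involutions pG bT (erefl 2)).
have sL4 : 'L_4(G) \subset <<A>>.
  apply: (lcn4_sub_of_comm (isT : prime 2) pG maxT nAG) => [|x h Gx Tx Gh].
    by rewrite gen_subG; apply: subset_trans sAG' sG'T.
  by apply: mem_gen; apply: imset2_f => //; rewrite inE Tx.
apply/trivgP; have sG2 := subset_trans (der2_sub_lcn4 G) sL4.
by apply: subset_trans (commgSS sG2 sG2) _; apply/trivgP/commG1P.
Qed.

(** For p = 2 the hypothesis of [baer2_involutions_der3] holds modulo the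
    centre of G'. *)
Lemma baer2_der4 (gT : finGroupType) (p : nat) (G T : {group gT}) :
  prime p -> p.-group G -> maximal T G ->
  {in G, forall y, y \notin T -> baer2_elt G y} -> G^`(4) = 1.
Proof.
move=> pr_p pG maxT bT.
suff sG3 : G^`(3) \subset 'Z(G^`(1)).
  apply/trivgP; apply: subset_trans (commgSS sG3 sG3) _.
  by apply/trivgP/commG1P/center_abelian.
have [p2|oddp] := even_prime pr_p; last first.
  apply: subset_trans (der_subS 2 G) _; apply: subset_trans (der2_sub_lcn4 G) _.
  exact: lcn4_center_odd pr_p pG maxT bT oddp.
rewrite p2 in pr_p pG; pose M : {group gT} := 'Z(G^`(1))%G.
have nMG : M <| G := center_der1_normal G.
have sMT : M \subset T := center_der1_sub pr_p pG maxT.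
have nM := normal_norm nMG; have sTG := proper_sub (max_proper maxT).
rewrite -quotient_sub1 ?(subset_trans (der_sub 3 G)) // quotient_der //.
rewrite (@baer2_involutions_der3 _ (G / M)%G (T / M)%G) ?quotient_pgroup //.
- by rewrite quotient_maximal // (normalS sMT sTG).
- move=> X GX nTX; have [x [Gx Nx nTx ->]] := lift_outside sMT GX nTX.
  move=> _ /morphimP[g Ng Gg ->]; rewrite -!morphJ ?groupJ //=.
  have /cycleP[k ->] := bT x Gx nTx g Gg.
  by rewrite morphX // mem_cycle.
move=> X _ GX nTX /morphimP[h Nh Gh ->].
have [x [Gx Nx nTx ->]] := lift_outside sMT GX nTX.
rewrite -morphJ // -morphR ?groupJ // -morphX ?groupR ?groupJ //=.
apply: coset_id; exact: baer2_comm_sqr pr_p pG maxT bT _ _ (erefl 2) Gx nTx Gh.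
Qed.

(** * From finite groups to locally finite groups *)

(** A finite subgroup of G given by the list of its elements, as a type that
    can carry a finite group structure. *)
Definition finite_subgroup (G : groupType) (s : seq G)
  of is_subgroup [set` s]%classic := seq_sub s.

Section FiniteSubgroup.

Variables (G : groupType) (s : seq G) (gs : is_subgroup [set` s]%classic).
Local Notation H := (finite_subgroup gs).

HB.instance Definition _ := Finite.copy H (seq_sub s).

Let one_s : 1 \in s. Proof. by case: gs. Qed.
Let mul_s (x y : H) : ssval x * ssval y \in s.
Proof. by case: gs => _ sM _; apply: sM; apply: ssvalP. Qed.
Let inv_s (x : H) : (ssval x)^-1 \in s.
Proof. by case: gs => _ _ sV; apply: sV; apply: ssvalP. Qed.

Let mulH (x y : H) : H := SeqSub (mul_s x y).
Let oneH : H := SeqSub one_s.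
Let invH (x : H) : H := SeqSub (inv_s x).

Let mulHA : associative mulH.
Proof. by move=> x y z; apply: val_inj; apply: mulgA. Qed.
Let mul1H : left_id oneH mulH.
Proof. by move=> x; apply: val_inj; apply: mul1g. Qed.
Let mulVH : left_inverse oneH invH mulH.
Proof. by move=> x; apply: val_inj; apply: mulVg. Qed.

HB.instance Definition _ := Finite_isGroup.Build H mulHA mul1H mulVH.

End FiniteSubgroup.

Definition embedding (G : groupType) (hT : finGroupType) (i : hT -> G) :=
  injective i /\ {morph i : x y / x * y}.

Lemma finite_subgroup_model (G : groupType) (s : seq G) :
  is_subgroup [set` s]%classic ->
  exists (hT : finGroupType) (i : hT -> G),
    embedding i /\ forall x, x \in s -> exists h, i h = x.
Proof.
move=> gs; exists (finite_subgroup gs), (fun h => ssval h); split.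
  by split=> [|//]; apply: val_inj.
by move=> x sx; exists (SeqSub sx).
Qed.

Section Embedding.

Variables (G : groupType) (hT : finGroupType) (i : hT -> G).
Hypothesis emb : embedding i.

Lemma embedding1 : i 1 = 1.
Proof. by apply: (mulgI (i 1)); rewrite -emb.2 !mulg1. Qed.

Lemma embeddingV x : i x^-1 = (i x)^-1.
Proof. by apply: (mulgI (i x)); rewrite -emb.2 !mulgV embedding1. Qed.

Lemma embeddingJ x y : i (x ^ y) = i x ^ i y.
Proof. by rewrite !conjgE !emb.2 embeddingV. Qed.

Lemma embeddingR x y : i [~ x, y] = [~ i x, i y].
Proof. by rewrite !commgEl emb.2 embeddingV embeddingJ. Qed.

Lemma embeddingX x n : i (x ^+ n) = i x ^+ n.
Proof. by elim: n => [|n IHn]; rewrite ?embedding1 // !expgS emb.2 IHn. Qed.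

End Embedding.

Lemma gen_ind (G : groupType) (A K : set G) y :
  is_subgroup K -> (A `<=` K)%classic -> gen A y -> K y.
Proof. by move=> gK AK; apply. Qed.

Lemma gen_subgroup (G : groupType) (A : set G) : is_subgroup (gen A).
Proof.
split=> [K [[K1 _ _] _] // | x y Ax Ay K AK | x Ax K AK].
  by case: (AK) => -[_ KM _] _; apply: KM; [apply: Ax | apply: Ay].
by case: (AK) => -[_ _ KV] _; apply: KV; apply: Ax.
Qed.

Lemma sub_gen (G : groupType) (A : set G) : (A `<=` gen A)%classic.
Proof. by move=> x Ax K [_]; apply. Qed.

(** F is a subgroup construction such as a term of the lower central series.
    An element y of G is locally in F if it belongs to the value of F on every
    finite subgroup of G that contains some finite set; the existence of a
    finite set, rather than of one finite subgroup, is what makes this property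
    stable under products. *)
Definition local_mem (G : groupType) (F : forall hT : finGroupType, {group hT})
    (y : G) : Prop :=
  exists s : seq G, forall (hT : finGroupType) (i : hT -> G),
    embedding i -> (forall x, x \in s -> exists h, i h = x) ->
  exists2 h, h \in F hT & i h = y.

Definition locally_in (G : groupType) (A : set G) F : Prop :=
  forall y, A y -> local_mem F y.

Lemma locally_in_setT (G : groupType) :
  locally_in [set: G]%classic (fun hT => [set: hT]%G).
Proof.
move=> y _; exists [:: y] => hT i _ /(_ y (mem_head _ _))[h <-].
by exists h.
Qed.

Lemma locally_in_comm (G : groupType) (A B : set G) E F :
  locally_in A E -> locally_in B F ->
  locally_in (comm_subgroup A B) (fun hT => [~: E hT, F hT]%G).
Proof.
move=> locA locB y; apply: gen_ind => [|_ [a Aa [b Bb <-]]].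
  split=> [|x z [s Ds] [t Dt]|x [s Ds]].
  - by exists [::] => hT i emb _; exists 1; rewrite ?(embedding1 emb).
  - exists (s ++ t) => hT i emb cov.
    have [u su|h Rh <-] := Ds hT i emb; first by apply: cov; rewrite mem_cat su.
    have [u tu|k Rk <-] := Dt hT i emb.
      by apply: cov; rewrite mem_cat tu orbT.
    by exists (h * k); rewrite ?groupM ?emb.2.
  exists s => hT i emb /(Ds hT i emb)[h Rh <-].
  by exists h^-1; rewrite ?groupV ?(embeddingV emb).
have [[s Ds] [t Dt]] := (locA a Aa, locB b Bb).
exists (s ++ t) => hT i emb cov.
have [x sx|h Eh <-] := Ds hT i emb; first by apply: cov; rewrite mem_cat sx.
have [x tx|k Fk <-] := Dt hT i emb.
  by apply: cov; rewrite mem_cat tx orbT.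
by exists [~ h, k]; rewrite ?mem_commg ?(embeddingR emb).
Qed.

Lemma locally_in_lower_central (G : groupType) n :
  locally_in (lower_central G n) (fun hT => 'L_n.+1([set: hT])%G).
Proof.
elim: n => [|n IHn]; first exact: locally_in_setT.
exact: locally_in_comm IHn (@locally_in_setT G).
Qed.

Lemma locally_in_derived (G : groupType) n :
  locally_in (derived_series G n) (fun hT => [set: hT]^`(n)%G).
Proof.
elim: n => [|n IHn]; first exact: locally_in_setT.
exact: (locally_in_comm IHn IHn).
Qed.

(** It is enough that F vanishes on cofinally many finite subgroups: one of them
    contains the finite set that witnesses a given element of A. *)
Lemma comm_series1 (G : groupType) (A : set G) (F : forall hT, {group hT}) :
  A 1 -> locally_in A F ->
  (forall s : seq G, exists (hT : finGroupType) (i : hT -> G),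
    [/\ embedding i, forall x, x \in s -> exists h, i h = x & F hT = 1%G]) ->
  A = [set 1]%classic.
Proof.
move=> A1 locA mods; apply/seteqP; split=> [y Ay | _ ->] //.
have [s Ds] := locA y Ay; have [hT [i [emb cov F1]]] := mods s.
have [h + <-] := Ds hT i emb cov.
by rewrite F1 => /set1P->; apply: embedding1.
Qed.

Lemma pgroup_of_elements (hT : finGroupType) (p : nat) :
  prime p -> (forall x : hT, exists k, x ^+ (p ^ k) = 1) -> p.-group [set: hT].
Proof.
move=> pr_p px; apply/pgroupP=> q pr_q /(Cauchy pr_q)[x _ ox].
have [k /eqP] := px x; rewrite -order_dvdn ox => qpk.
by move: qpk; rewrite Euclid_dvdX // dvdn_prime2 // => /andP[].
Qed.

Lemma subnormal2_conj (G : groupType) (x g : G) :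
  subnormal2 (cyc x) -> cyc x (x ^ (x ^ g)).
Proof.
case=> K [[_ _ sxK nxK] [_ _ _ nK]].
have xx : cyc x x by apply: sub_gen.
by apply: nxK => //; apply: nK => //; apply: sxK.
Qed.

Lemma embedding_cyc (G : groupType) (hT : finGroupType) (i : hT -> G) h k :
  embedding i -> cyc (i h) (i k) -> k \in <[h]>.
Proof.
move=> emb ck; pose K y := exists2 k', k' \in <[h]> & i k' = y.
have : K (i k).
  move: (i k) ck => y; apply: (@gen_ind G [set i h]%classic K); last first.
    by move=> _ ->; exists h; rewrite ?cycle_id.
  split=> [|_ _ [a ha <-] [b hb <-] | _ [a ha <-]].
  - by exists 1; rewrite ?(embedding1 emb).
  - by exists (a * b); rewrite ?groupM ?emb.2.
  - by exists a^-1; rewrite ?groupV ?(embeddingV emb).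
by case=> k' hk' /emb.1 <-.
Qed.

(** The finite subgroup is generated by s and one element x0 outside T2 G; the
    elements of T2 G in it form a proper subgroup, contained in a maximal
    subgroup T. *)
Lemma generalized_2Baer_models (p : nat) (G : groupType) (s : seq G) :
  prime p -> locally_finite_group G -> p_group p G -> generalized_2Baer G ->
  exists (hT : finGroupType) (i : hT -> G),
    [/\ embedding i, forall x, x \in s -> exists h, i h = x,
        p.-group [set: hT]
      & exists2 T : {group hT}, maximal T [set: hT] &
          {in [set: hT], forall y, y \notin T -> baer2_elt [set: hT] y}].
Proof.
move=> pr_p lfG pG T2G.
have [x0 nx0] : exists x0, ~ T2 G x0.
  apply: contrapT => nT; apply: T2G; apply/seteqP; split=> // x _.
  by apply: contrapT => nx; apply: nT; exists x.
have /finite_seqP[r Dr] := lfG [set` x0 :: s]%classic (finite_seq _).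
have gr : is_subgroup [set` r]%classic by rewrite -Dr; apply: gen_subgroup.
have [hT [i [emb cov]]] := finite_subgroup_model gr.
have cov' x : x \in x0 :: s -> exists h, i h = x.
  move=> sx; apply: cov; suff : [set` r]%classic x by [].
  by rewrite -Dr; apply: sub_gen.
have pH : p.-group [set: hT].
  apply: pgroup_of_elements => // h; have [k Dk] := pG (i h).
  by exists k; apply: emb.1; rewrite (embeddingX emb) Dk (embedding1 emb).
exists hT, i; split=> // [x sx|]; first by apply: cov'; rewrite inE sx orbT.
have [T1 TM TV] := gen_subgroup [set x : G | ~ subnormal2 (cyc x)]%classic.
have gT0 : group_set [set h : hT | `[< T2 G (i h) >]].
  apply/group_setP; split=> [|h k]; rewrite !inE.
    by apply/asboolP; rewrite (embedding1 emb); apply: T1.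
  by move=> /asboolP Th /asboolP Tk; apply/asboolP; rewrite emb.2; apply: TM.
pose T0 := Group gT0.
have [h0 Dh0] := cov' x0 (mem_head _ _).
have [DT|[T maxT sT0T]] := maximal_exists (subsetT T0).
  have : h0 \in T0 by rewrite DT; apply: in_setT.
  by rewrite inE Dh0 => /asboolP.
exists T => // y _ nTy g _; apply: (embedding_cyc emb).
rewrite !(embeddingJ emb); apply: subnormal2_conj; apply: contrapT => ny.
case/negP: nTy; apply: (subsetP sT0T); rewrite inE.
apply/asboolP; exact: sub_gen.
Qed.

Lemma baer2_lower_central6 (p : nat) (G : groupType) :
  prime p -> locally_finite_group G -> p_group p G ->
  generalized_2Baer G -> 3 < p -> lower_central G 6 = [set 1]%classic.
Proof.
move=> pr_p lfG pG bG p3.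
apply: comm_series1 (@locally_in_lower_central G 6) _.
  by case: (gen_subgroup
    [set [~ a, b] | a in lower_central G 5 & b in [set: G]]%classic).
move=> s; have [hT [i [emb cov pH [T maxT bT]]]] :=
  generalized_2Baer_models s pr_p lfG pG bG.
exists hT, i; split=> //; apply: val_inj.
exact: baer2_lcn7 pr_p pH maxT bT p3.
Qed.

Lemma baer2_derived4 (p : nat) (G : groupType) :
  prime p -> locally_finite_group G -> p_group p G ->
  generalized_2Baer G -> derived_series G 4 = [set 1]%classic.
Proof.
move=> pr_p lfG pG bG.
apply: comm_series1 (@locally_in_derived G 4) _.
  by case: (gen_subgroup [set [~ a, b] |
    a in derived_series G 3 & b in derived_series G 3]%classic).
move=> s; have [hT [i [emb cov pH [T maxT bT]]]] :=
  generalized_2Baer_models s pr_p lfG pG bG.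
exists hT, i; split=> //; apply: val_inj.
exact: baer2_der4 pr_p pH maxT bT.
Qed.

Theorem theorem2p8 :
  (forall (p : nat) (G : groupType),
     prime p -> locally_finite_group G -> p_group p G ->
     generalized_2Baer G -> p <> 5 -> soluble G) /\
  (exists c : nat, forall (p : nat) (G : groupType),
     prime p -> locally_finite_group G -> p_group p G ->
     generalized_2Baer G -> (5 < p)%N -> nilpotent_of_class_le G c) /\
  (exists f : nat -> nat, forall (G : groupType) (l : nat),
     locally_finite_group G -> p_group 5 G ->
     generalized_2Baer G -> soluble_of_length G l ->
     nilpotent_of_class_le G (f l)).
Proof.
split; first by move=> p G pr_p lfG pG bG _; exists 4%N;
  apply: (baer2_derived4 pr_p lfG pG bG).
split.
  exists 6 => p G pr_p lfG pG bG p5.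
  by apply: (baer2_lower_central6 pr_p lfG pG bG); apply: ltn_trans p5.
exists (fun=> 6) => G l lfG pG bG _.
exact: (baer2_lower_central6 (isT : prime 5) lfG pG bG).
Qed.
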